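(* Let $f\in\mathbb{R}[t_1,\dots,t_n]$ be a homogeneous polynomial of degree $d\ge2$, let $\mathscr{K}$ be an open convex cone, and let $\mathbf{w}\in\mathscr{K}$. Then $f$ is $\mathscr{K}$-Lorentzian if and only if for all $\mathbf{u}_1,\dots,\mathbf{u}_{d-2}\in S_\mathscr{K}$ and all $0\le k\le d-2$, the quadratic polynomial $D_{\mathbf{u}_1}\cdots D_{\mathbf{u}_k}D_\mathbf{w}^{d-2-k}f$ is $\mathscr{K}$-Lorentzian.
   Context: $D_\mathbf{u}=\sum u_i\partial_i$. $S_\mathscr{K}$ is the set of unit vectors generating extreme rays of $\overline{\mathscr{K}}$. A homogeneous $g$ of degree $m\ge1$ is $\mathscr{K}$-Lorentzian if for all $\mathbf{v}_1,\dots,\mathbf{v}_m\in\mathscr{K}$, $D_{\mathbf{v}_1}\cdots D_{\mathbf{v}_m}g>0$ and (when $m\ge2$) the bilinear form $(\mathbf{x},\mathbf{y})\mapsto D_\mathbf{x}D_\mathbf{y}D_{\mathbf{v}_3}\cdots D_{\mathbf{v}_m}g$ has exactly one positive eigenvalue; nonnegative constants are $\mathscr{K}$-Lorentzian.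
   Formalization: The closure of the cone K is additionally assumed to contain no line; otherwise S_K is empty and the claim fails for d ≥ 3 (e.g. K = {x_1 > 0} in R^2, f = -t_1^3, or f = t_1^3 + t_2^3 with w = e_1 if k = 0 is still tested). *)

(* Defs.v *)
From HB Require Import structures.
From mathcomp Require Import all_boot all_order all_algebra.
From mathcomp Require Import all_classical all_reals topology normedtype convex.
(* The notations of mpoly clash with those of MathComp-Analysis. *)
From mathcomp Require Import -(notations) mpoly.

Set Implicit Arguments.
Unset Strict Implicit.
Unset Printing Implicit Defensive.

Import Order.TTheory GRing.Theory Num.Theory.
Import numFieldNormedType.Exports.

Local Open Scope classical_set_scope.
Local Open Scope ring_scope.

Definition homogeneous (R : realType) (n d : nat) (g : mpoly n R) : Prop :=
  g \is ishomog1 d (@mdeg n).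

(* For a constant polynomial, its value. *)
Definition const_coeff (R : realType) (n : nat) (g : mpoly n R) : R :=
  mcoeff (@mnm0 n) g.

Definition dirD (R : realType) (n : nat) (u : 'rV[R]_n)
    (g : mpoly n R) : mpoly n R :=
  \sum_(i < n) u ord0 i *: mderiv i g.

(* dirDs [:: v1; ...; vm] g is D_v1 ... D_vm g. *)
Definition dirDs (R : realType) (n : nat) (vs : seq 'rV[R]_n)
    (g : mpoly n R) : mpoly n R :=
  foldr (@dirD R n) g vs.

(* Gram matrix, in the standard basis, of (x, y) |-> D_x D_y q; q is meant to
   be homogeneous of degree 2, so that these derivatives are constants. *)
Definition form_mx (R : realType) (n : nat) (q : mpoly n R) : 'M[R]_n :=
  \matrix_(i < n, j < n)
    const_coeff (dirD (delta_mx ord0 i) (dirD (delta_mx ord0 j) q)).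

(* Eigenvalues are counted with multiplicity: s is the full spectrum, which
   exists for every real symmetric A. *)
Definition one_pos_eigenvalue (R : realType) (n : nat) (A : 'M[R]_n) : Prop :=
  exists s : seq R,
    char_poly A = \prod_(a <- s) ('X - a%:P) /\ count (fun a => 0 < a) s = 1%N.

(* The constant clause comes from the convention that nonnegative constants are
   Lorentzian. It covers the zero polynomial, which is homogeneous of every
   degree; for every other g the degree m is determined by g. *)
Definition Lorentzian (R : realType) (n : nat) (K : set 'rV[R]_n)
    (g : mpoly n R) : Prop :=
  (exists2 c : R, 0 <= c & g = mpolyC n c) \/
  (exists m : nat, [/\ (1 <= m)%N, homogeneous m g &
     forall vs : m.-tuple 'rV[R]_n, (forall i : 'I_m, K (tnth vs i)) ->
       0 < const_coeff (dirDs vs g) /\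
       ((2 <= m)%N -> one_pos_eigenvalue (form_mx (dirDs (drop 2 vs) g)))]).

Definition open_convex_cone (R : realType) (n : nat) (K : set 'rV[R]_n) : Prop :=
  [/\ open K,
      convex_set (K : set (convex_lmodType 'rV[R]_n)) &
      forall (a : R) (x : 'rV[R]_n), 0 < a -> K x -> K (a *: x)].

Definition pointed (R : realType) (n : nat) (C : set 'rV[R]_n) : Prop :=
  forall x : 'rV[R]_n, C x -> C (- x) -> x = 0.

Definition ray (R : realType) (n : nat) (u : 'rV[R]_n) : set 'rV[R]_n :=
  [set x | exists2 t : R, 0 <= t & x = t *: u].

Definition extreme_ray (R : realType) (n : nat) (C : set 'rV[R]_n)
    (u : 'rV[R]_n) : Prop :=
  [/\ u != 0, ray u `<=` C &
      forall x y : 'rV[R]_n, C x -> C y -> ray u (x + y) -> ray u x /\ ray u y].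

(* Euclidean unit vectors: the library norm on 'rV is the sup norm. *)
Definition extreme_units (R : realType) (n : nat) (K : set 'rV[R]_n)
    : set 'rV[R]_n :=
  [set u : 'rV[R]_n | \sum_(i < n) u ord0 i ^+ 2 = 1 /\ extreme_ray (closure K) u].

(* Main.v *)
Require Import Defs.
From HB Require Import structures.
From mathcomp Require Import all_boot all_order all_algebra.
From mathcomp Require Import all_classical all_reals topology normedtype convex.
From mathcomp Require Import -(notations) mpoly.
From mathcomp Require Import ring lra interval_inference derive.
From mathcomp Require complex.

(** For [d >= 2] and up to the zero polynomial, being Lorentzian amounts to
    nonnegativity of all mixed derivatives along [K] together with reverse
    Cauchy-Schwarz inequalities for the derivatives of degree two.
    These conditions are closed, so they persist when directions move to the
    boundary of [K], which gives one implication.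

    For the converse, induction on the degree reduces everything to cubics [g]
    such that [D_u g] is Lorentzian for every extreme direction [u] and [D_w g]
    is Lorentzian; one has to show that [D_v g] is Lorentzian for [v] in [K].
    By Minkowski's theorem [v] and [w] are positive combinations of finitely many
    extreme directions [u_i], so [g] becomes a symmetric tensor with slices
    [D_{u_i} g].  For a positive combination [c], summing the inequalities
    [Q_i(x,x) Q_i(c,c) <= Q_i(x,c)^2] of the slices gives
    [<A x, x> <= <A x, A x>] for the self-adjoint operator [A] representing the
    Hessian [Q_c] in a suitable inner product.  Hence [A] has no eigenvalue in
    the open interval (0, 1), so the number of positive eigenvalues cannot change
    along the segment from [w] to [v]. *)

Set Implicit Arguments.
Unset Strict Implicit.
Unset Printing Implicit Defensive.

Import Order.TTheory GRing.Theory Num.Theory.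
Import numFieldNormedType.Exports.

Local Open Scope classical_set_scope.
Local Open Scope ring_scope.

(** * Bilinear forms given by square matrices *)

Definition bil (F : comPzRingType) (n : nat) (A : 'M[F]_n) (x y : 'rV[F]_n) : F :=
  (x *m A *m y^T) ord0 ord0.

Section Bilinear.
Variables (F : comPzRingType) (n : nat).
Implicit Types (A : 'M[F]_n) (x y z : 'rV[F]_n).

Lemma bilDl A x y z : bil A (x + y) z = bil A x z + bil A y z.
Proof. by rewrite /bil !mulmxDl mxE. Qed.

Lemma bilZl A a x z : bil A (a *: x) z = a * bil A x z.
Proof. by rewrite /bil -!scalemxAl mxE. Qed.

Lemma bilDr A x y z : bil A z (x + y) = bil A z x + bil A z y.
Proof. by rewrite /bil linearD mulmxDr mxE. Qed.

Lemma bilZr A a x z : bil A z (a *: x) = a * bil A z x.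
Proof. by rewrite /bil linearZ -scalemxAr mxE. Qed.

Lemma bil0 x y : bil 0 x y = 0.
Proof. by rewrite /bil mulmx0 mul0mx mxE. Qed.

Lemma bilC A x y : A^T = A -> bil A x y = bil A y x.
Proof.
move=> sA; rewrite /bil -[in RHS]mulmxA -[in LHS](trmxK (_ *m _)) mxE.
by rewrite !trmx_mul trmxK sA mulmxA.
Qed.

Lemma bil_sum I (r : seq I) (c : I -> F) (A : I -> 'M[F]_n) x y :
  bil (\sum_(i <- r) c i *: A i) x y = \sum_(i <- r) c i * bil (A i) x y.
Proof.
rewrite /bil mulmx_sumr mulmx_suml summxE; apply: eq_bigr => i _.
by rewrite -scalemxAr -scalemxAl mxE.
Qed.

Lemma bilE A x y :
  bil A x y = \sum_i \sum_j x ord0 i * A i j * y ord0 j.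
Proof.
rewrite /bil mxE exchange_big /=; apply: eq_bigr => j _.
by rewrite !mxE mulr_suml; apply: eq_bigr.
Qed.

Lemma bil_delta A i j : bil A (delta_mx ord0 i) (delta_mx ord0 j) = A i j.
Proof. by rewrite /bil -rowE trmx_delta -colE !mxE. Qed.

End Bilinear.

(* In the presence of a vector [v] on which the form is positive, both
   conditions say that the form has Lorentzian signature. *)
Lemma reverse_CS_orthogonal (R : realFieldType) n (A : 'M[R]_n) v :
  A^T = A -> 0 < bil A v v ->
  (forall x, bil A x x * bil A v v <= bil A x v ^+ 2) <->
  (forall x, bil A x v = 0 -> bil A x x <= 0).
Proof.
move=> sA v0; split=> H x.
  by move=> xv; have := H x; rewrite xv expr0n pmulr_lle0.
pose y := bil A v v *: x + (- bil A x v) *: v.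
have /H : bil A y v = 0 by rewrite bilDl !bilZl; ring.
rewrite !(bilDl, bilDr, bilZl, bilZr) (bilC v x sA).
set a := bil A x x; set b := bil A v v; set c := bil A x v => h.
have : b * (a * b - c ^+ 2) <= 0.
  by apply: le_trans h; rewrite le_eqVlt; apply/orP; left; apply/eqP; ring.
by rewrite pmulr_rle0 // subr_le0.
Qed.

(** * Diagonalisation of real symmetric matrices *)

Lemma char_poly_conj (F : fieldType) n (P A : 'M[F]_n) :
  P \in unitmx -> char_poly (invmx P *m A *m P) = char_poly A.
Proof.
move=> Pu; rewrite /char_poly.
have -> : char_poly_mx (invmx P *m A *m P) =
    map_mx polyC (invmx P) *m char_poly_mx A *m map_mx polyC P.
  rewrite /char_poly_mx mulmxBr mulmxBl -!map_mxM /=; congr (_ - _).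
  by rewrite scalar_mxC -mulmxA -map_mxM mulVmx // map_mx1 mulmx1.
rewrite !det_mulmx mulrC mulrA -det_mulmx -map_mxM mulmxV //.
by rewrite map_mx1 det1 mul1r.
Qed.

Section Spectral.
Import complex ComplexField.
Local Open Scope sesquilinear_scope.
Local Open Scope complex_scope.
Variables (R : rcfType) (n : nat).
Local Notation C := R[i].
Local Notation toC := (real_complex R).

Definition herm (A : 'M[C]_n) (x y : 'rV[C]_n) : C := bil A x (map_mx Num.conj y).

(** The spectral theorem is applied to the complexification of [A]. The eigenvalues are real, so the
    factorisation of the characteristic polynomial descends to [R]; [x *m P] lists the coordinates
    of [x] in a basis of eigenvectors. *)
Lemma hermitian_diagonal (A : 'M[R]_n) : A^T = A ->
  exists (d : 'I_n -> R) (P : 'M[C]_n),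
  [/\ P \in unitmx,
      char_poly A = \prod_i ('X - (d i)%:P) &
      forall x y, herm (map_mx toC A) x y =
        \sum_i (d i)%:C * (x *m P) ord0 i * Num.conj ((y *m P) ord0 i)].
Proof.
move=> sA; pose B := map_mx toC A.
have hB : B \is hermsymmx.
  apply: realsym_hermsym; last by apply/mxOverP => i j; rewrite mxE complex_real.
  by apply/is_hermitianmxP; rewrite expr0 scale1r map_mx_id // map_trmx sA.
have /orthomx_spectralP BE := hermitian_normalmx hB.
have /mxOverP dreal := hermitian_spectral_diag_real hB.
have Pun := spectral_unitarymx B.
have Pu : spectralmx B \in unitmx := spectral_unit _.
set P := spectralmx B in BE Pu Pun *.
set D := spectral_diag B in BE dreal *.
exists (fun i => Re (D ord0 i)), (invmx P).
have DE i : (Re (D ord0 i))%:C = D ord0 i by rewrite RRe_real.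
split; first by rewrite unitmx_inv.
  apply: (map_inj_poly (@complexI R) (rmorph0 toC)).
  rewrite map_char_poly -/B BE char_poly_conj // char_poly_trig ?diag_mx_is_trig //.
  rewrite rmorph_prod /=; apply: eq_bigr => i _.
  by rewrite mxE eqxx mulr1n rmorphB /= map_polyX map_polyC /= DE.
move=> x y; rewrite /herm -/B {1}BE /bil.
have -> : x *m (invmx P *m diag_mx D *m P) *m (map_mx Num.conj y)^T =
   (x *m invmx P) *m diag_mx D *m (map_mx Num.conj (y *m invmx P))^T.
  rewrite map_mxM trmx_mul !mulmxA; congr (_ *m _ *m _).
  by rewrite (invmx_unitary Pun) map_trmx trmxCK.
rewrite mxE; apply: eq_bigr => i _; rewrite mul_mx_diag !mxE DE.
by congr (_ * _); rewrite mulrC.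
Qed.

Lemma hermDl A x y z : herm A (x + y) z = herm A x z + herm A y z.
Proof. exact: bilDl. Qed.

Lemma hermZl A a x z : herm A (a *: x) z = a * herm A x z.
Proof. exact: bilZl. Qed.

Lemma hermDr A x y z : herm A z (x + y) = herm A z x + herm A z y.
Proof. by rewrite /herm map_mxD bilDr. Qed.

Lemma hermZr A a x z : herm A z (a *: x) = Num.conj a * herm A z x.
Proof. by rewrite /herm map_mxZ bilZr. Qed.

Lemma herm_real (A : 'M[R]_n) x y :
  herm (map_mx toC A) (map_mx toC x) (map_mx toC y) = (bil A x y)%:C.
Proof.
rewrite /herm /bil.
have -> : map_mx Num.conj (map_mx toC y) = map_mx toC y.
  by apply/rowP => i; rewrite !mxE conj_Creal // complex_real.
by rewrite map_trmx -!map_mxM mxE.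
Qed.

End Spectral.

(** * Lorentzian signature and reverse Cauchy-Schwarz *)

Section OnePositiveEigenvalue.
Import complex ComplexField.
Local Open Scope complex_scope.
Variables (R : realType) (n : nat).
Local Notation C := R[i].
Local Notation toC := (real_complex R).

(** Count the positive [d i]. If there is just one, the form is nonpositive on the kernel of its
    coordinate. If there were two, their eigenvectors would span a plane on which the form is
    positive definite, and this plane meets the orthogonal complement of [v]. *)
Lemma one_pos_eigenvalueP (A : 'M[R]_n) v : A^T = A -> 0 < bil A v v ->
  one_pos_eigenvalue A <->
  (forall x, bil A x x * bil A v v <= bil A x v ^+ 2).
Proof.
move=> sA v0; rewrite reverse_CS_orthogonal //.
have [d [P [Pu cA hA]]] := hermitian_diagonal sA.
set B := map_mx toC A in hA.
pose m := #|[pred i | 0 < d i]|.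
have -> : one_pos_eigenvalue A <-> m = 1%N.
  have E : char_poly A = \prod_(a <- [seq d i | i <- enum 'I_n]) ('X - a%:P).
    by rewrite cA big_map big_enum.
  have -> : m = count (fun a => 0 < a) [seq d i | i <- enum 'I_n].
    by rewrite count_map /m cardE enumT /enum_mem size_filter.
  split=> [[s [cs <-]]|m1]; last by exists [seq d i | i <- enum 'I_n].
  by apply/permP; apply: prod_XsubC_eq; rewrite -E -cs.
pose V := map_mx toC v.
have normE (x : C) : 0 <= x * Num.conj x by rewrite mul_conjC_ge0.
split=> [m1 y yv|H].
  have [i0 Hi0] : exists i0, [pred i | 0 < d i] =i pred1 i0.
    by apply/card1P; rewrite -/m m1.
  have le0 z : (z *m P) ord0 i0 = 0 -> herm B z z <= 0.
    move=> zi0; rewrite hA; apply: sumr_le0 => i _; rewrite -mulrA.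
    have [->|ni] := eqVneq i i0; first by rewrite zi0 mul0r mulr0.
    apply: mulr_le0_ge0 => //; rewrite lecR leNgt.
    by have := Hi0 i; rewrite !inE (negbTE ni) => ->.
  pose Y := map_mx toC y.
  set b := (V *m P) ord0 i0; set a := (Y *m P) ord0 i0.
  have b0 : b != 0.
    by apply/eqP => /le0; rewrite herm_real lecR leNgt v0.
  (* This combination kills the coordinate [i0], and its cross terms vanish because [y] is
     orthogonal to [v]. *)
  have : herm B (b *: Y + (- a) *: V) (b *: Y + (- a) *: V) <= 0.
    apply: le0; rewrite mulmxDl -!scalemxAl.
    by rewrite mxE [X in X + _]mxE [X in _ + X]mxE -/a -/b mulNr [a * b]mulrC subrr.
  rewrite !(hermDl, hermDr, hermZl, hermZr) !herm_real (bilC v y sA) yv rmorph0.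
  rewrite !mulr0 addr0 add0r => h.
  have : b * Num.conj b * (bil A y y)%:C <= 0.
    apply: le_trans h; rewrite -mulrA lerDl.
    rewrite rmorphN !mulNr ?mulrN ?opprK mulrA mulr_ge0 ?lecR ?(ltW v0) //.
  by rewrite pmulr_rle0 ?mul_conjC_gt0 // lecR.
(* Orthogonality to the real vector [V] passes to the real and imaginary parts of [z], where [H]
   applies. *)
have HC z : herm B z V = 0 -> herm B z z <= 0.
  pose x := map_mx (@Re R) z; pose y := map_mx (@Im R) z.
  have -> : z = map_mx toC x + 'i *: map_mx toC y.
    by apply/rowP => i; rewrite !mxE -complexE.
  rewrite !(hermDl, hermDr, hermZl, hermZr) !herm_real.
  have -> : Num.conj ('i : C) = - 'i by apply/eqP; rewrite eq_complex /= oppr0 !eqxx.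
  rewrite (bilC y x sA) => /eqP; rewrite eq_complex /= => /andP[].
  rewrite !(mul0r, mul1r, mulr0, subr0, addr0, add0r) => /eqP xv /eqP yv.
  rewrite mulrA mulrN -expr2 sqr_i opprK mul1r mulNr addrA subrK -rmorphD.
  by rewrite lecR -[leRHS]addr0 lerD // H.
have m0 : (0 < m)%N.
  rewrite lt0n; apply/negP => /eqP/card0_eq m0.
  have : herm B V V <= 0.
    rewrite hA; apply: sumr_le0 => i _; rewrite -mulrA mulr_le0_ge0 // lecR leNgt.
    by have := m0 i; rewrite !inE => ->.
  by rewrite herm_real lecR leNgt v0.
have [/card_gt1P[p [q [dp dq pq]]]|m1] := ltnP 1 m; last first.
  by apply/eqP; rewrite eqn_leq m1 m0.
rewrite !inE in dp dq.
pose w i := (d i)%:C * Num.conj ((V *m P) ord0 i).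
(* One linear equation in two unknowns: it provides a nonzero vector orthogonal to [V] in the plane
   of the eigenvectors [p] and [q]. *)
have [al [be [ab0 E]]] : exists al be : C, (al, be) != 0 /\ al * w p + be * w q = 0.
  have [wp0|wp0] := eqVneq (w p) 0.
    by exists 1, 0; rewrite wp0 mulr0 mul0r addr0 xpair_eqE oner_eq0.
  exists (- w q), (w p); split; last by ring.
  by rewrite xpair_eqE (negbTE wp0) andbF.
pose z := (al *: delta_mx ord0 p + be *: delta_mx ord0 q : 'rV_n) *m invmx P.
have zP : z *m P = al *: delta_mx ord0 p + be *: delta_mx ord0 q by rewrite mulmxKV.
have zPp : (z *m P) ord0 p = al
  by rewrite zP !mxE !eqxx /= (negbTE pq) mulr1 mulr0 addr0.
have zPq : (z *m P) ord0 q = be.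
  by rewrite zP !mxE !eqxx /= eq_sym (negbTE pq) mulr1 mulr0 add0r.
have zPo i : i != p -> i != q -> (z *m P) ord0 i = 0.
  by move=> ip iq; rewrite zP !mxE (negbTE ip) (negbTE iq) !mulr0 addr0.
have sum2 (F : 'I_n -> C) : (forall i, i != p -> i != q -> F i = 0) ->
    \sum_i F i = F p + F q.
  move=> F0; rewrite (bigD1 p) //= (bigD1 q) /=; last by rewrite eq_sym.
  by rewrite big1 ?addr0 // => i /andP[]; exact: F0.
have : herm B z z <= 0.
  apply: HC; rewrite hA sum2 => [|i ip iq]; last by rewrite zPo // mulr0 mul0r.
  by rewrite zPp zPq -E /w; ring.
rewrite hA sum2 => [|i ip iq]; last by rewrite zPo // mulr0 mul0r.
rewrite zPp zPq -!mulrA => h; exfalso; move: h; apply/negP.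
have h x i : 0 < d i -> x != 0 -> 0 < (d i)%:C * (x * Num.conj x).
  by move=> di x0; rewrite mulr_gt0 ?ltcR ?mul_conjC_gt0.
have h' x i : 0 < d i -> 0 <= (d i)%:C * (x * Num.conj x).
  by move=> /ltW di; rewrite mulr_ge0 ?lecR.
rewrite lt_geF //; move: ab0; rewrite xpair_eqE negb_and => /orP[] ?.
  by rewrite ltr_wpDr ?h ?h'.
by rewrite ltr_wpDl ?h ?h'.
Qed.

End OnePositiveEigenvalue.

(** * Closed and compact sets defined by continuous functions *)

Section ContinuousRealFunctions.
Variables (R : realType) (X : topologicalType).
Implicit Types f g : X -> R.

Lemma continuous_add f g :
  continuous f -> continuous g -> continuous (fun x => f x + g x).
Proof. by move=> fc gc x; apply: cvgD; [exact: fc|exact: gc]. Qed.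

Lemma continuous_mul f g :
  continuous f -> continuous g -> continuous (fun x => f x * g x).
Proof. by move=> fc gc x; apply: cvgM; [exact: fc|exact: gc]. Qed.

Lemma continuous_opp f : continuous f -> continuous (fun x => - f x).
Proof. by move=> fc x; apply: cvgN; exact: fc. Qed.

Lemma continuous_const (a : R) : continuous (fun _ : X => a).
Proof. by move=> x; exact: cvg_cst. Qed.

Lemma continuous_big I (r : seq I) (F : I -> X -> R) :
  (forall i, continuous (F i)) -> continuous (fun x => \sum_(i <- r) F i x).
Proof.
move=> Fc; elim: r => [|i r IH].
  by under eq_fun do rewrite big_nil; exact: continuous_const.
by under eq_fun do rewrite big_cons; exact: continuous_add.
Qed.

Lemma continuous_sqr f : continuous f -> continuous (fun x => f x ^+ 2).
Proof. by move=> fc; under eq_fun do rewrite expr2; exact: continuous_mul. Qed.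

Lemma closed_le_fun f g : continuous f -> continuous g ->
  closed [set x | f x <= g x].
Proof.
move=> fc gc.
have -> : [set x | f x <= g x] = (fun x => g x + - f x) @^-1` [set y | 0 <= y].
  by apply/seteqP; split=> x /=; rewrite subr_ge0.
apply: (proj1 (continuous_closedP _)); last exact: closed_ge.
by apply: continuous_add => //; exact: continuous_opp.
Qed.

Lemma closed_eq_fun f g : continuous f -> continuous g ->
  closed [set x | f x = g x].
Proof.
move=> fc gc.
have -> : [set x | f x = g x] = [set x | f x <= g x] `&` [set x | g x <= f x].
  apply/seteqP; split=> x /= => [->|[h1 h2]]; first by [].
  by apply/eqP; rewrite eq_le h1 h2.
by apply: closedI; exact: closed_le_fun.
Qed.

End ContinuousRealFunctions.

Lemma closed_bounded_coord_compact (R : realType) n (A : set 'rV[R]_n)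
    (B : 'I_n -> R) :
  closed A -> (forall x, A x -> forall i, `|x ord0 i| <= B i) -> compact A.
Proof.
move=> cA AB; pose I i := `[- B i, B i]%classic.
have cI : compact [set v : 'rV[R]_n | forall i, I i (v ord0 i)].
  by apply: rV_compact => i; exact: segment_compact.
apply: subclosed_compact cA cI _ => x Ax i.
by rewrite /I /= in_itv /= -ler_norml AB.
Qed.

Lemma sum_sqr_gt0 (R : realDomainType) n (x : 'rV[R]_n) :
  x != 0 -> 0 < \sum_i x ord0 i ^+ 2.
Proof.
move=> x0; rewrite lt_def sumr_ge0 ?andbT => [|i _]; last exact: sqr_ge0.
apply: contraNneq x0 => /eqP.
rewrite psumr_eq0 => [/allP h|i _]; last exact: sqr_ge0.
apply/eqP/rowP => i; rewrite mxE; apply/eqP; rewrite -sqrf_eq0.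
by apply: (implyP (h i _)) => //; rewrite mem_index_enum.
Qed.

(** * Symmetric tensors of order three *)

Section Tensor.
Variables (R : realType) (n : nat) (T : 'I_n -> 'M[R]_n).
Hypothesis T_sym : forall i, (T i)^T = T i.
Hypothesis T_swap : forall i j k, T i j k = T j i k.
Implicit Types c x y z : 'rV[R]_n.

(** When [T i] is the form of [D_{u_i} g] in the frame of the [u_i], this is the form of the
    derivative of [g] along the combination of the [u_i] with coefficients [c]. *)
Definition contr c : 'M[R]_n := \sum_i c ord0 i *: T i.

Definition tri c x y : R := bil (contr c) x y.

Lemma triE c x y : tri c x y = \sum_i c ord0 i * bil (T i) x y.
Proof. exact: bil_sum. Qed.

Lemma contr_sym c : (contr c)^T = contr c.
Proof.
by rewrite /contr linear_sum; apply: eq_bigr => i _; rewrite linearZ /= T_sym.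
Qed.

Lemma triC c x y : tri c x y = tri c y x.
Proof. exact/bilC/contr_sym. Qed.

Lemma tri_swap c x y : tri c x y = tri x c y.
Proof.
rewrite !triE.
under eq_bigr do rewrite bilE mulr_sumr.
under [RHS]eq_bigr do rewrite bilE mulr_sumr.
rewrite exchange_big; apply: eq_bigr => i _; apply: eq_bigr => j _.
rewrite !mulr_sumr; apply: eq_bigr => k _; rewrite T_swap; ring.
Qed.

Lemma tri_last c x y : tri c x y = \sum_i y ord0 i * bil (T i) c x.
Proof. by rewrite triC tri_swap triE. Qed.

Lemma continuous_tri (X : topologicalType) (c x y : X -> 'rV[R]_n) :
  (forall i, continuous (fun p => c p ord0 i)) ->
  (forall i, continuous (fun p => x p ord0 i)) ->
  (forall i, continuous (fun p => y p ord0 i)) ->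
  continuous (fun p => tri (c p) (x p) (y p)).
Proof.
move=> cc xc yc.
under eq_fun do rewrite triE.
apply: continuous_big => i; apply: continuous_mul => //.
under eq_fun do rewrite bilE.
apply: continuous_big => j; apply: continuous_big => k.
apply: continuous_mul => //; apply: continuous_mul => //.
exact: continuous_const.
Qed.

(** Rescaled coordinates, in which [c] becomes the all-ones vector. *)
Definition hadamard c z : 'rV[R]_n := \row_i (c ord0 i * z ord0 i).

(* The summand [(T i == 0)%:R] only keeps the weight positive when [T i]
   vanishes; such an index contributes nothing to the forms below. *)
Definition weight c i : R := bil (T i) c c + (T i == 0)%:R.

(** The inner product for which [shift] below is self-adjoint and represents [qf]. *)
Definition wdot c x y : R :=
  \sum_i c ord0 i * weight c i * (x ord0 i * y ord0 i).

Lemma wdotDl c x y z : wdot c (x + y) z = wdot c x z + wdot c y z.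
Proof. by rewrite /wdot -big_split; apply: eq_bigr => i _; rewrite !mxE /=; ring. Qed.

Lemma wdotZl c a x z : wdot c (a *: x) z = a * wdot c x z.
Proof. by rewrite /wdot mulr_sumr; apply: eq_bigr => i _; rewrite !mxE /=; ring. Qed.

Lemma wdotC c x y : wdot c x y = wdot c y x.
Proof. by apply: eq_bigr => i _; ring. Qed.

Lemma hadamardD c x y : hadamard c (x + y) = hadamard c x + hadamard c y.
Proof. by apply/rowP => i; rewrite !mxE mulrDr. Qed.

Lemma hadamardZ c a x : hadamard c (a *: x) = a *: hadamard c x.
Proof. by apply/rowP => i; rewrite !mxE; ring. Qed.

Definition qf c x y : R := tri c (hadamard c x) (hadamard c y).

Lemma qfDl c x y z : qf c (x + y) z = qf c x z + qf c y z.
Proof. by rewrite /qf hadamardD /tri bilDl. Qed.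

Lemma qfZl c a x z : qf c (a *: x) z = a * qf c x z.
Proof. by rewrite /qf hadamardZ /tri bilZl. Qed.

Lemma qfC c x y : qf c x y = qf c y x.
Proof. exact: triC. Qed.

Lemma continuous_wdot (X : topologicalType) (c z : X -> 'rV[R]_n) :
  (forall i, continuous (fun p => c p ord0 i)) ->
  (forall i, continuous (fun p => z p ord0 i)) ->
  continuous (fun p => wdot (c p) (z p) (z p)).
Proof.
move=> cc zc; apply: continuous_big => i.
apply: continuous_mul; last exact: continuous_mul.
apply: continuous_mul => //.
apply: continuous_add; last exact: continuous_const.
under eq_fun do rewrite bilE.
apply: continuous_big => j; apply: continuous_big => k.
apply: continuous_mul => //; apply: continuous_mul => //.
exact: continuous_const.
Qed.

Lemma continuous_hadamard (X : topologicalType) (c z : X -> 'rV[R]_n) :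
  (forall i, continuous (fun p => c p ord0 i)) ->
  (forall i, continuous (fun p => z p ord0 i)) ->
  forall i, continuous (fun p => hadamard (c p) (z p) ord0 i).
Proof.
by move=> cc zc i; under eq_fun do rewrite mxE; exact: continuous_mul.
Qed.

(** * The spectral gap: no eigenvalue strictly between 0 and 1 *)

Section Gap.
Variable c : 'rV[R]_n.
Hypothesis c_gt0 : forall i, 0 < c ord0 i.
Hypothesis T_ge0 : forall i, 0 <= bil (T i) c c.
Hypothesis T_eq0 : forall i, bil (T i) c c = 0 -> T i = 0.
Hypothesis T_CS : forall i x, bil (T i) x x * bil (T i) c c <= bil (T i) x c ^+ 2.

Lemma weight_gt0 i : 0 < weight c i.
Proof.
rewrite /weight; have [->|Ti] := eqVneq (T i) 0.
  by rewrite bil0 add0r.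
by rewrite addr0 lt_def T_ge0 andbT; apply: contraNN Ti => /eqP/T_eq0 ->.
Qed.

Lemma wdot_coord x i : c ord0 i * weight c i * x ord0 i ^+ 2 <= wdot c x x.
Proof.
rewrite /wdot (bigD1 i) //= -expr2 lerDl; apply: sumr_ge0 => j _.
apply: mulr_ge0; last by rewrite -expr2 sqr_ge0.
by apply: mulr_ge0; apply: ltW => //; exact: weight_gt0.
Qed.

Lemma wdot_gt0 x : x != 0 -> 0 < wdot c x x.
Proof.
move=> x0; have [i xi] : exists i, x ord0 i != 0.
  by apply/existsP; apply: contraNT x0 => /existsPn h; apply/eqP/rowP => i;
    rewrite mxE; apply/eqP; rewrite -[_ == _]negbK h.
apply: lt_le_trans (wdot_coord x i).
by rewrite pmulr_rgt0 ?exprn_even_gt0 // mulr_gt0 ?weight_gt0.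
Qed.

(** This is the operator [A] representing the Hessian: by [wdot_shift], pairing with [shift y] gives
    the form [qf]. *)
Definition shift y : 'rV[R]_n :=
  \row_i (bil (T i) c (hadamard c y) / weight c i).

Lemma wdot_shift x y : wdot c x (shift y) = qf c x y.
Proof.
rewrite qfC /qf tri_last; apply: eq_bigr => i _; rewrite !mxE.
by field; rewrite gt_eqF // weight_gt0.
Qed.

(** Up to coordinates with [T i = 0], the all-ones vector is an eigenvector of [shift] for the
    eigenvalue 1. Hence the hyperplane orthogonal to it is stable. *)
Lemma tri_shift y : tri c (hadamard c (shift y)) c = tri c (hadamard c y) c.
Proof.
rewrite [LHS]triC [LHS]tri_last [RHS]tri_last; apply: eq_bigr => i _.
rewrite !mxE; have [Ti|Ti] := eqVneq (T i) 0.
  have b0 x z : bil (T i) x z = 0 by rewrite Ti bil0.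
  by rewrite !b0 !(mulr0, mul0r).
have wE : weight c i = bil (T i) c c by rewrite /weight (negbTE Ti) addr0.
by rewrite wE; field; rewrite -wE gt_eqF // weight_gt0.
Qed.

(* This is the Bochner-type inequality [<A x, x> <= <A x, A x>]. *)
Lemma qf_le_shift y : qf c y y <= wdot c (shift y) (shift y).
Proof.
rewrite /qf triE; apply: ler_sum => i _; rewrite -mulrA ler_pM2l // !mxE.
have [Ti|Ti] := eqVneq (T i) 0.
  rewrite Ti bil0 -Ti; apply: mulr_ge0; last by rewrite -expr2 sqr_ge0.
  exact/ltW/weight_gt0.
have wE : weight c i = bil (T i) c c by rewrite /weight (negbTE Ti) addr0.
(* After multiplication by the weight this is [T_CS] at the vector [hadamard c y]. *)
have w0 := weight_gt0 i; rewrite -(ler_pM2r w0) {1}wE.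
apply: le_trans (T_CS _ _) _; rewrite bilC // le_eqVlt; apply/orP; left.
by apply/eqP; field; rewrite gt_eqF.
Qed.

(* A maximiser of the form on the ellipsoid [wdot <= 1] is an eigenvector for
   an eigenvalue [mu] with [mu <= mu ^+ 2]. *)
Lemma spectral_gap z :
  tri c (hadamard c z) c = 0 -> 0 < qf c z z ->
  exists y, [/\ y != 0, tri c (hadamard c y) c = 0 & wdot c y y <= qf c y y].
Proof.
move=> z0 qz.
pose S := [set y : 'rV[R]_n | wdot c y y <= 1] `&`
  [set y | tri c (hadamard c y) c = 0].
have coordc i : continuous (fun y : 'rV[R]_n => y ord0 i).
  exact: coord_continuous.
have cstc i : continuous (fun y : 'rV[R]_n => c ord0 i).
  exact: continuous_const.
have closedS : closed S.
  apply: closedI.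
    by apply: closed_le_fun; [exact: continuous_wdot|exact: continuous_const].
  apply: closed_eq_fun; last exact: continuous_const.
  by apply: continuous_tri => //; exact: continuous_hadamard.
have compactS : compact S.
  (* The bound on the square of a coordinate becomes a bound on the coordinate through
     [t <= t ^+ 2 + 1]. *)
  apply: (@closed_bounded_coord_compact _ _ _ (fun i => (c ord0 i * weight c i)^-1 + 1))
    closedS _ => x [/= x1 _] i.
  have w0 : 0 < c ord0 i * weight c i by rewrite mulr_gt0 ?weight_gt0.
  have := le_trans (wdot_coord x i) x1.
  rewrite mulrC -ler_pdivlMr // mul1r -[in X in X <= _]real_normK ?num_real // => h.
  have := sqr_ge0 (`|x ord0 i| - 1); have := sqr_ge0 (`|x ord0 i|).
  by rewrite sqrrB expr1n mulr1; lra.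
have [y yS ymax] : exists2 y, y \in S & forall t, t \in S -> qf c t t <= qf c y y.
  apply: EVT_max_rV compactS _.
    exists 0; split; rewrite /= ?/wdot.
      by rewrite big1 // => i _; rewrite mxE !mulr0.
    by rewrite -(scale0r 0) hadamardZ /tri bilZl mul0r.
  apply: continuous_subspaceT.
  by apply: continuous_tri => //; exact: continuous_hadamard.
move: yS; rewrite inE => -[/= y1 y0].
have wZ a x : wdot c (a *: x) (a *: x) = a ^+ 2 * wdot c x x.
  by rewrite wdotZl wdotC wdotZl; ring.
have qZ a x : qf c (a *: x) (a *: x) = a ^+ 2 * qf c x x.
  by rewrite qfZl qfC qfZl; ring.
have q00 : qf c 0 0 = 0 by have := qZ 0 0; rewrite scale0r expr0n mul0r.
have LZ a x : tri c (hadamard c x) c = 0 -> tri c (hadamard c (a *: x)) c = 0.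
  by move=> h; rewrite hadamardZ /tri bilZl -/(tri _ _ _) h mulr0.
(* By homogeneity, maximality on the ellipsoid bounds the Rayleigh quotient on the whole
   hyperplane. *)
have qmax x : tri c (hadamard c x) c = 0 -> qf c x x <= qf c y y * wdot c x x.
  move=> x0; have [->|xn0] := eqVneq x 0.
    by have := wZ 0 0; rewrite scale0r q00 => ->; rewrite expr0n mul0r mulr0.
  have w0 := wdot_gt0 xn0.
  have := ymax ((Num.sqrt (wdot c x x))^-1 *: x).
  rewrite qZ exprVn sqr_sqrtr ?(ltW w0) // mulrC ler_pdivrMr //; apply.
  rewrite inE; split; last exact: LZ.
  by rewrite /= wZ exprVn sqr_sqrtr ?(ltW w0) // mulVf ?gt_eqF.
set mu := qf c y y in ymax qmax.
have mu_gt0 : 0 < mu.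
  have := lt_le_trans qz (qmax z z0).
  by rewrite pmulr_lgt0 // wdot_gt0 //; apply: contraTneq qz => ->;
    rewrite q00 ltxx.
(* As the maximum is positive, it is attained on the boundary of the ellipsoid. *)
have w1 : wdot c y y = 1.
  by apply/eqP; rewrite eq_le y1 -(ler_pM2l mu_gt0) mulr1 qmax.
exists y; split => //.
  by apply: contraTneq mu_gt0 => yE; rewrite /mu yE q00 ltxx.
rewrite w1 -/mu.
set v := shift y.
have v0 : tri c (hadamard c v) c = 0 by rewrite tri_shift.
(* Perturb [y] along [v], which stays in the hyperplane by [tri_shift]. The terms linear in [s] will
   give [wdot c v v <= mu ^+ 2], the equality case of Cauchy-Schwarz for [y] and [v]. *)
have ineq s : 2 * s * wdot c v v + s ^+ 2 * qf c v v <=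
    2 * s * mu ^+ 2 + s ^+ 2 * (mu * wdot c v v).
  have /qmax : tri c (hadamard c (y + s *: v)) c = 0.
    by rewrite hadamardD /tri bilDl -!/(tri _ _ _) y0 LZ // addr0.
  rewrite !(qfDl, wdotDl, qfZl, wdotZl).
  rewrite !(qfC _ _ (y + s *: v)) !(wdotC _ _ (y + s *: v)).
  rewrite !(qfDl, wdotDl, qfZl, wdotZl) w1.
  have -> : wdot c y v = mu by rewrite wdot_shift.
  have -> : wdot c v y = mu by rewrite wdotC wdot_shift.
  have -> : qf c v y = wdot c v v by rewrite wdot_shift.
  have -> : qf c y v = wdot c v v by rewrite qfC wdot_shift.
  rewrite -/mu; lra.
have muv := qf_le_shift y; rewrite -/mu -/v in muv.
have : wdot c v v <= mu ^+ 2.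
  have h1 (a b : R) : (forall s, s * a <= s ^+ 2 * b) -> a <= 0.
    move=> h; rewrite leNgt; apply/negP => a0.
    have d0 : 0 < `|b| + a by rewrite ltr_wpDl.
    have := h (a / (`|b| + a)); rewrite leNgt => /negP; apply.
    set s := a / _; have s0 : 0 < s by rewrite divr_gt0.
    have sE : s * (`|b| + a) = a by rewrite mulfVK ?gt_eqF.
    rewrite expr2 -mulrA ltr_pM2l // -[ltRHS]sE ltr_pM2l //.
    by rewrite (le_lt_trans (ler_norm b)) // ltrDl.
  rewrite -subr_le0; apply: (h1 _ ((mu * wdot c v v - qf c v v) / 2)) => s.
  by have := ineq s; lra.
(* Both bounds on [wdot c v v] combine to [mu <= mu ^+ 2], whence [1 <= mu]. *)
move=> h; have : mu * 1 <= mu * mu by rewrite mulr1 -expr2 (le_trans muv).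
by rewrite ler_pM2l.
Qed.

End Gap.

(** * Persistence of the signature along a segment *)

Section Homotopy.
Variables a b : 'rV[R]_n.
Hypothesis a_gt0 : forall i, 0 < a ord0 i.
Hypothesis b_gt0 : forall i, 0 < b ord0 i.

Definition path_pt (t : R) : 'rV[R]_n := (1 - t) *: a + t *: b.

Hypothesis T_ge0 : forall (t : R) i, 0 <= t <= 1 ->
  0 <= bil (T i) (path_pt t) (path_pt t).
Hypothesis T_eq0 : forall (t : R) i, 0 <= t <= 1 ->
  bil (T i) (path_pt t) (path_pt t) = 0 -> T i = 0.
Hypothesis T_CS : forall (t : R) i x, 0 <= t <= 1 ->
  bil (T i) x x * bil (T i) (path_pt t) (path_pt t) <= bil (T i) x (path_pt t) ^+ 2.

Lemma path_gt0 t i : 0 <= t <= 1 -> 0 < path_pt t ord0 i.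
Proof.
move=> /andP[t0 t1]; rewrite !mxE.
have [->|tn0] := eqVneq t 0; first by rewrite mul0r subr0 mul1r addr0.
rewrite ltr_wpDl ?mulr_ge0 ?subr_ge0 ?(ltW (a_gt0 i)) //.
by rewrite mulr_gt0 // lt_def tn0.
Qed.

Lemma continuous_path (X : topologicalType) (t : X -> R) :
  continuous t -> forall i, continuous (fun p => path_pt (t p) ord0 i).
Proof.
move=> tc i; under eq_fun do rewrite !mxE.
apply: continuous_add; apply: continuous_mul => //; try exact: continuous_const.
by apply: continuous_add; [exact: continuous_const|exact: continuous_opp].
Qed.

Definition good t := forall x, tri (path_pt t) x x *
  tri (path_pt t) (path_pt t) (path_pt t) <= tri (path_pt t) x (path_pt t) ^+ 2.

Lemma closed_good : closed [set t | good t].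
Proof.
have -> : [set t | good t] = \bigcap_x [set t | tri (path_pt t) x x *
    tri (path_pt t) (path_pt t) (path_pt t) <= tri (path_pt t) x (path_pt t) ^+ 2].
  by apply/seteqP; split=> t h x => [_|]; [exact: h|exact: (h x I)].
have idc : continuous (fun t : R => t) by move=> t; exact: cvg_id.
have pc := continuous_path idc.
have xc (x : 'rV[R]_n) i : continuous (fun t : R => x ord0 i).
  exact: continuous_const.
apply: closed_bigI => x _; apply: closed_le_fun.
  by apply: continuous_mul; exact: continuous_tri.
by apply: continuous_sqr; exact: continuous_tri.
Qed.

(** Failure of [good] is a strict inequality, hence an open condition. The spectral gap makes it
    equivalent to the existence of such a witness, and this is a closed condition. *)
Definition bad_witness (p : R * 'rV[R]_n) :=
  [/\ \sum_i p.2 ord0 i ^+ 2 = 1,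
      tri (path_pt p.1) (hadamard (path_pt p.1) p.2) (path_pt p.1) = 0 &
      wdot (path_pt p.1) p.2 p.2 <= qf (path_pt p.1) p.2 p.2].

(** The set is the first projection of a closed subset of the compact product of [[0, 1]] and the
    unit sphere. *)
Lemma closed_bad : closed [set t | 0 <= t <= 1 /\ exists z, bad_witness (t, z)].
Proof.
pose S := [set z : 'rV[R]_n | \sum_i z ord0 i ^+ 2 = 1].
have coordc i : continuous (fun z : 'rV[R]_n => z ord0 i).
  exact: coord_continuous.
have compactS : compact S.
  apply: (@closed_bounded_coord_compact _ _ _ (fun=> 1)).
    apply: closed_eq_fun; last exact: continuous_const.
    by apply: continuous_big => i; exact: continuous_sqr.
  move=> z /= z1 i; rewrite -(@expr_le1 _ 2) // real_normK ?num_real //.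
  by rewrite -z1 (bigD1 i) //= lerDl; apply: sumr_ge0 => j _; exact: sqr_ge0.
pose K := [set p : R * 'rV[R]_n | 0 <= p.1] `&` [set p | p.1 <= 1] `&`
  [set p | bad_witness p].
have -> : [set t | 0 <= t <= 1 /\ exists z, bad_witness (t, z)] = fst @` K.
  apply/seteqP; split=> [t [/andP[t0 t1] [z bz]]|_ [[t z] [[/= t0 t1] bz] <-]].
    by exists (t, z).
  by split; [rewrite t0 t1|exists z].
have fstc : continuous (@fst R 'rV[R]_n) by move=> p; exact: cvg_fst.
have zc i : continuous (fun p : R * 'rV[R]_n => p.2 ord0 i).
  by move=> p; apply: (@continuous_comp _ _ _ snd (fun z : 'rV[R]_n => z ord0 i));
    [exact: cvg_snd|exact: coordc].
have pc := continuous_path fstc.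
apply: compact_closed; first exact: Rhausdorff.
apply: continuous_compact; first exact: continuous_subspaceT.
have cRS : compact (`[0, 1]%classic `*` S : set (R * 'rV[R]_n)).
  by apply: compact_setX => //; exact: segment_compact.
have KS : K `<=` `[0, 1]%classic `*` S.
  by move=> p [[/= p0 p1] []]; split=> //=; rewrite in_itv /= p0 p1.
apply: (subclosed_compact _ cRS KS).
- apply: closedI.
    by apply: closedI; apply: closed_le_fun => //; exact: continuous_const.
  have -> : [set p : R * 'rV[R]_n | bad_witness p] =
     [set p : R * 'rV[R]_n | \sum_i p.2 ord0 i ^+ 2 = 1] `&`
     [set p : R * 'rV[R]_n |
       tri (path_pt p.1) (hadamard (path_pt p.1) p.2) (path_pt p.1) = 0] `&`
     [set p : R * 'rV[R]_n | wdot (path_pt p.1) p.2 p.2 <= qf (path_pt p.1) p.2 p.2].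
    by apply/seteqP; split=> p /= [] => [h1 h2 h3|[]].
  apply: closedI; [apply: closedI|].
  - apply: closed_eq_fun; last exact: continuous_const.
    by apply: continuous_big => i; exact: continuous_sqr.
  - apply: closed_eq_fun; last exact: continuous_const.
    by apply: continuous_tri => //; exact: continuous_hadamard.
  - apply: closed_le_fun; first exact: continuous_wdot.
    by apply: continuous_tri => //; exact: continuous_hadamard.
Qed.

(** In [[0, 1]] the good parameters form a closed set, and by the gap they are the complement of the
    closed set [bad]. Connectedness concludes. *)
Lemma good_path_end : good 0 -> good 1.
Proof.
move=> good0.
(* The zero tensor is trivial. Otherwise one nonzero slice makes the form positive at [path_pt t]
   for every [t], as [reverse_CS_orthogonal] requires. *)
have [T0|/existsP[i0 Ti0]] := boolP [forall i, T i == 0].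
  move=> x; have b0 y z : tri (path_pt 1) y z = 0.
    rewrite triE big1 // => i _; rewrite (eqP (forallP T0 i)).
    by rewrite bil0 mulr0.
  by rewrite !b0 mul0r expr0n.
have pos t : 0 <= t <= 1 -> 0 < tri (path_pt t) (path_pt t) (path_pt t).
  move=> t01; rewrite triE (bigD1 i0) //= ltr_wpDr //.
    by apply: sumr_ge0 => i _; rewrite mulr_ge0 ?T_ge0 // ltW // path_gt0.
  rewrite mulr_gt0 ?path_gt0 // lt_def T_ge0 // andbT.
  by apply: contraNneq Ti0 => /T_eq0 ->.
pose bad := [set t | 0 <= t <= 1 /\ exists z, bad_witness (t, z)].
have dichotomy t : 0 <= t <= 1 -> good t <-> ~ bad t.
  move=> t01; set c := path_pt t.
  have sc := contr_sym c.
  rewrite /good -/c; split.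
    move=> /(reverse_CS_orthogonal sc (pos t t01)) g [_ [z [z1 /= z0]]].
    rewrite -/c in z0 *; have := g _ z0; rewrite -/(qf c z z) => h1 /le_trans/(_ h1).
    rewrite leNgt => /negP; apply; apply: wdot_gt0 => //.
    - by move=> i; exact: path_gt0.
    - by move=> i; exact: T_ge0.
    - by move=> i; exact: T_eq0.
    apply: contra_eq_neq z1 => ->; rewrite big1 ?(eq_sym 0) ?oner_eq0 // => i _.
    by rewrite mxE expr0n.
  move=> nb; apply/(reverse_CS_orthogonal sc (pos t t01)) => x xc.
  rewrite leNgt; apply/negP => xx.
  apply: nb; split=> //.
  (* Passing to rescaled coordinates is possible because all coordinates of [c] are positive. *)
  pose z : 'rV[R]_n := \row_i (x ord0 i / c ord0 i).
  have xE : x = hadamard c z.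
    apply/rowP => i; rewrite [RHS]mxE.
    have -> : z ord0 i = x ord0 i / c ord0 i by rewrite /z mxE.
    by rewrite mulrC mulfVK // gt_eqF // path_gt0.
  rewrite xE in xc xx.
  have [||||y [y0 yc yy]] := spectral_gap _ _ _ _ xc xx.
  - by move=> i; exact: path_gt0.
  - by move=> i; exact: T_ge0.
  - by move=> i; exact: T_eq0.
  - by move=> i y; exact: T_CS.
  pose N := \sum_i y ord0 i ^+ 2.
  have N0 : 0 < N := sum_sqr_gt0 y0.
  exists ((Num.sqrt N)^-1 *: y); split=> /=; rewrite -/c.
  - under eq_bigr do rewrite mxE exprMn exprVn sqr_sqrtr ?(ltW N0) //.
    by rewrite -mulr_sumr mulVf // gt_eqF.
  - by rewrite hadamardZ /tri bilZl -/(tri _ _ _) yc mulr0.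
  have s0 : 0 < (Num.sqrt N)^-1 by rewrite invr_gt0 sqrtr_gt0.
  by rewrite wdotZl wdotC wdotZl qfZl qfC qfZl !(ler_pM2l s0).
pose G := `[0, 1]%classic `&` [set t | good t].
suff : G 1 by case.
have GE : G = `[0, 1]%classic.
  apply: (@segment_connected R 0 1).
  - by exists 0; split=> //=; rewrite in_itv /= lexx ler01.
  - exists (~` bad); first exact/closed_openC/closed_bad.
    apply/seteqP; split=> t [t01 gt]; split=> //; move: (t01);
      rewrite /= in_itv /= => /dichotomy [h1 h2]; [exact: h1|exact: h2].
  - by exists [set t | good t] => //; exact: closed_good.
by rewrite GE /= in_itv /= lexx ler01.
Qed.

End Homotopy.
End Tensor.

(** * Finitely generated cones and extreme rays *)

Section Cones.
Variables (R : realType) (n : nat).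
Implicit Types (x y z : 'rV[R]_n).

Lemma closed_right0 (D : set R) : closed D -> (forall e, 0 < e -> D e) -> D 0.
Proof.
move=> cD Dpos; apply: contrapT => D0.
have /nbhs_ballP[e /= e0 eD] : nbhs (0 : R) (~` D).
  by apply: open_nbhs_nbhs; split=> //; exact: closed_openC.
apply: (eD (e / 2)); last by apply: Dpos; rewrite divr_gt0.
by rewrite /ball /= sub0r normrN gtr0_norm ?divr_gt0 // ltr_pdivrMr // ltr_pMr // ltr1n.
Qed.

Lemma closure_sub_closed (X : topologicalType) (A B : set X) :
  closed B -> A `<=` B -> closure A `<=` B.
Proof.
by move=> cB AB; rewrite [B](proj1 (closure_id _) cB); exact: closure_subset.
Qed.

Lemma continuous_line x y : continuous (fun s : R => x + s *: y).
Proof.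
move=> s; apply: cvgD; first exact: cvg_cst.
by apply: cvgZr_tmp; exact: cvg_id.
Qed.

Definition cone_of N (U : 'M[R]_(N, n)) x :=
  exists2 c : 'rV[R]_N, forall i, 0 <= c ord0 i & x = c *m U.

Lemma cone_of_add N (U : 'M_(N, n)) x y :
  cone_of U x -> cone_of U y -> cone_of U (x + y).
Proof.
move=> [c c0 ->] [e e0 ->]; exists (c + e); last by rewrite mulmxDl.
by move=> i; rewrite mxE addr_ge0.
Qed.

Lemma cone_of_scale N (U : 'M_(N, n)) a x :
  0 <= a -> cone_of U x -> cone_of U (a *: x).
Proof.
move=> a0 [c c0 ->]; exists (a *: c); last by rewrite scalemxAl.
by move=> i; rewrite mxE mulr_ge0.
Qed.

Lemma cone_of0 N (U : 'M_(N, n)) : cone_of U 0.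
Proof. by exists 0; rewrite ?mul0mx // => i; rewrite mxE. Qed.

Lemma cone_of_colL N N' (U : 'M_(N, n)) (V : 'M_(N', n)) x :
  cone_of U x -> cone_of (col_mx U V) x.
Proof.
move=> [c c0 ->]; exists (row_mx c 0); last by rewrite mul_row_col mul0mx addr0.
by move=> i; rewrite mxE; case: splitP => j _; rewrite ?mxE.
Qed.

Lemma cone_of_colR N N' (U : 'M_(N, n)) (V : 'M_(N', n)) x :
  cone_of V x -> cone_of (col_mx U V) x.
Proof.
move=> [c c0 ->]; exists (row_mx 0 c); last by rewrite mul_row_col mul0mx add0r.
by move=> i; rewrite mxE; case: splitP => j _; rewrite ?mxE.
Qed.

(** For [C] the closure of [K] this is [extreme_units K]; Minkowski's theorem is proved for a
    general [C]. *)
Definition unit_extreme (C : set 'rV[R]_n) (u : 'rV[R]_n) :=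
  \sum_(i < n) u ord0 i ^+ 2 = 1 /\ extreme_ray C u.

Lemma unit_extreme_col C N N' (U : 'M_(N, n)) (V : 'M_(N', n)) :
  (forall i, unit_extreme C (row i U)) -> (forall i, unit_extreme C (row i V)) ->
  forall i, unit_extreme C (row i (col_mx U V)).
Proof.
move=> hU hV i; case: (split_ordP i) => j ->.
  by rewrite rowKu.
by rewrite rowKd.
Qed.

Definition generated C x :=
  exists N (U : 'M_(N, n)), (forall i, unit_extreme C (row i U)) /\ cone_of U x.

Lemma generated_add C x y : generated C x -> generated C y -> generated C (x + y).
Proof.
move=> [N [U [hU Ux]]] [N' [V [hV Vy]]]; exists (N + N')%N, (col_mx U V); split.
  exact: unit_extreme_col.
by apply: cone_of_add; [exact: cone_of_colL|exact: cone_of_colR].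
Qed.

Lemma generated_scale C a x : 0 <= a -> generated C x -> generated C (a *: x).
Proof.
by move=> a0 [N [U [hU Ux]]]; exists N, U; split=> //; exact: cone_of_scale.
Qed.

Lemma generated0 C : generated C 0.
Proof.
by exists 0%N, 0; split=> [[]//|]; exact: cone_of0.
Qed.

Lemma ray_scale a x : 0 < a -> ray (a *: x) = ray x.
Proof.
move=> a0; apply/seteqP; split=> y [t t0 ->].
  by exists (t * a); rewrite ?scalerA // mulr_ge0 // ltW.
exists (t / a); first by rewrite divr_ge0 // ltW.
by rewrite scalerA mulfVK // gt_eqF.
Qed.

Lemma extreme_ray_scale C a x : 0 < a -> extreme_ray C x -> extreme_ray C (a *: x).
Proof.
move=> a0 [x0 rC xE]; split; rewrite ?ray_scale //.
by rewrite scaler_eq0 negb_or gt_eqF.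
Qed.

Lemma generated_extreme C x : extreme_ray C x -> generated C x.
Proof.
move=> xE; have x0 : x != 0 by case: xE.
have N0 := sum_sqr_gt0 x0; set N := \sum_i _ in N0.
have s0 : 0 < Num.sqrt N by rewrite sqrtr_gt0.
exists 1%N, ((Num.sqrt N)^-1 *: x); split.
  move=> i; rewrite row_id; split; last by apply: extreme_ray_scale; rewrite ?invr_gt0.
  under eq_bigr do rewrite mxE exprMn exprVn sqr_sqrtr ?(ltW N0) //.
  by rewrite -mulr_sumr mulVf // gt_eqF.
exists (Num.sqrt N)%:M; first by move=> i; rewrite (ord1 i) mxE eqxx mulr1n ltW.
by rewrite mul_scalar_mx scalerA mulfV ?scale1r // gt_eqF.
Qed.

(** * Minkowski's theorem for closed pointed cones *)

Section Minkowski.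
Variable C : set 'rV[R]_n.
Hypothesis C_closed : closed C.
Hypothesis C_add : forall x y, C x -> C y -> C (x + y).
Hypothesis C_scale : forall a x, 0 <= a -> C x -> C (a *: x).
Hypothesis C_pointed : pointed C.

(** If arbitrarily large multiples of [y] could be subtracted, dividing by them would put [- y] in
    the closed cone [C], against pointedness. So a supremum exists, and it is attained. *)
Lemma max_subtract x y : C x -> C y -> y != 0 ->
  exists s, [/\ 0 <= s, C (x - s *: y) & forall t, s < t -> ~ C (x - t *: y)].
Proof.
move=> Cx Cy y0.
pose S := [set s : R | 0 <= s /\ C (x - s *: y)].
have cS : closed S.
  have -> : S = [set s : R | 0 <= s] `&` ((fun s => x + s *: (- y)) @^-1` C).
    by apply/seteqP; split=> s /=; rewrite scalerN.
  apply: closedI; first exact: closed_ge.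
  by apply: (proj1 (continuous_closedP _)) => //; exact: continuous_line.
have S0 : S 0 by split; rewrite // scale0r subr0.
have ubS : has_ubound S.
  apply: contrapT => nub.
  have big M : exists2 s, M < s & S s.
    apply: contrapT => h; apply: nub; exists M => s Ss.
    by rewrite leNgt; apply/negP => Ms; apply: h; exists s.
  have : ((fun s => - y + s *: x) @^-1` C) 0.
    apply: closed_right0.
      by apply: (proj1 (continuous_closedP _)) => //; exact: continuous_line.
    move=> e e0 /=; have [s es [s0 Cs]] := big e^-1.
    have sgt : 0 < s by rewrite (lt_trans _ es) ?invr_gt0.
    have -> : - y + e *: x = s^-1 *: (x - s *: y) + (e - s^-1) *: x.
      by apply/rowP => i; rewrite !mxE; field; rewrite gt_eqF.
    apply: C_add; apply: C_scale => //; first by rewrite invr_ge0.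
    by rewrite subr_ge0 -[e]invrK lef_pV2 ?posrE ?invr_gt0 // ltW.
  rewrite /= scale0r addr0 => /(C_pointed Cy) y00.
  by rewrite y00 eqxx in y0.
have [s0 Cs] : S (sup S).
  have : closure S (sup S) by apply: closure_sup => //; exists 0.
  by rewrite -(proj1 (closure_id _) cS).
exists (sup S); split=> // t st Ct.
have /(ub_le_sup ubS) : S t by split=> //; exact: le_trans (ltW st).
by rewrite leNgt st.
Qed.

(** For [x] in [C], these [y] form the smallest face of [C] containing [x]. *)
Definition face x y := C y /\ exists2 t, 0 <= t & C (t *: x - y).

Definition face_span x y := exists a b, [/\ face x a, face x b & y = a - b].

Lemma face_refl x : C x -> face x x.
Proof.
move=> Cx; split=> //; exists 1 => //; rewrite scale1r subrr.
by rewrite -(scale0r x); exact: C_scale.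
Qed.

Lemma face_trans y x z : face x y -> face y z -> face x z.
Proof.
move=> [Cy [t t0 h]] [Cz [t' t'0 h']]; split=> //; exists (t' * t).
  by rewrite mulr_ge0.
have -> : (t' * t) *: x - z = t' *: (t *: x - y) + (t' *: y - z).
  by rewrite scalerBr scalerA addrA subrK.
by apply: C_add => //; exact: C_scale.
Qed.

Lemma face_add x y z : face x y -> face x z -> face x (y + z).
Proof.
move=> [Cy [t t0 h]] [Cz [t' t'0 h']]; split; first exact: C_add.
exists (t + t'); first exact: addr_ge0.
have -> : (t + t') *: x - (y + z) = (t *: x - y) + (t' *: x - z).
  by rewrite scalerDl opprD addrACA.
exact: C_add.
Qed.

Lemma face_scale a x y : 0 <= a -> face x y -> face x (a *: y).
Proof.
move=> a0 [Cy [t t0 h]]; split; first exact: C_scale.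
exists (a * t); first exact: mulr_ge0.
by rewrite -scalerA -scalerBr; exact: C_scale.
Qed.

Lemma face_span_add x y z : face_span x y -> face_span x z -> face_span x (y + z).
Proof.
move=> [a [b [fa fb ->]]] [c [e [fc fe ->]]].
by exists (a + c), (b + e); split; rewrite ?opprD 1?addrACA //; exact: face_add.
Qed.

Lemma face_span_scale a x y : face_span x y -> face_span x (a *: y).
Proof.
move=> [b [c [fb fc ->]]]; have [a0|a0] := leP 0 a.
  by exists (a *: b), (a *: c); split; rewrite ?scalerBr //; exact: face_scale.
exists ((- a) *: c), ((- a) *: b); split;
  try by apply: face_scale => //; rewrite oppr_ge0 ltW.
by rewrite !scaleNr opprK scalerBr addrC.
Qed.

Lemma face_span_face x y : face x y -> face_span x y.
Proof.
move=> fy; exists (2 *: y), y; split=> //; first by apply: face_scale.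
by rewrite scaler_nat mulr2n addrK.
Qed.

Lemma face_span_submx x m (B : 'M_(m, n)) z : C x ->
  (forall i, face_span x (row i B)) -> (z <= B)%MS -> face_span x z.
Proof.
move=> Cx hB /submxP[D ->]; rewrite mulmx_sum_row.
apply: (big_ind (face_span x)).
- by rewrite -(scale0r x); apply/face_span_scale/face_span_face/face_refl.
- by move=> ? ?; exact: face_span_add.
- by move=> i _; exact: face_span_scale.
Qed.

(* The dimension of the linear span of the smallest face containing [x] is at
   most [k]. *)
Definition face_dim_le x k :=
  forall B : 'M[R]_n, (forall i, face_span x (row i B)) -> (\rank B <= k)%N.

Lemma face_dim_drop x p q s k : C x -> C q -> q != 0 -> face x p -> face x q ->
  0 <= s -> C (p - s *: q) -> (forall t, s < t -> ~ C (p - t *: q)) ->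
  face_dim_le x k.+1 -> face_dim_le (p - s *: q) k.
Proof.
move=> Cx Cq q0 fp fq s0 Cp1 smax dx B hB; set p1 := p - s *: q in Cp1 hB *.
have fp1 : face x p1.
  apply: face_trans fp _; split=> //; exists 1 => //.
  by rewrite scale1r /p1 opprB addrC subrK; exact: C_scale.
have qB : ~~ (q <= B)%MS.
  apply/negP => /(face_span_submx Cp1 hB) [a [b [[Ca [t t0 Cta]] [Cb _] qE]]].
  (* With [q = a - b], the vector [(t + 1) *: p1 - q] is the sum of [t *: p1 - a], [b] and [p1], all
     in [C]. *)
  apply: (smax (s + (t + 1)^-1)); first by rewrite ltrDl invr_gt0 ltr_wpDl.
  have t1 : 0 < t + 1 by rewrite ltr_wpDl.
  have -> : p - (s + (t + 1)^-1) *: q = (t + 1)^-1 *: ((t *: p1 - a) + b + p1).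
    by rewrite /p1 qE; apply/rowP => i; rewrite !mxE; field; rewrite gt_eqF.
  apply: C_scale; first by rewrite invr_ge0 ltW.
  by apply: C_add => //; exact: C_add.
have : (\rank (B + q)%MS <= k.+1)%N.
  apply: dx => i; have /sub_addsmxP[[u1 u2] /= ->] : (row i (B + q)%MS <= B + q)%MS.
    exact: row_sub.
  apply: face_span_add.
    have [a [b [fa fb ->]]] := face_span_submx Cp1 hB (submxMl u1 B).
    by exists a, b; split=> //; exact: face_trans fp1 _.
  rewrite [u2]mx11_scalar mul_scalar_mx.
  by apply/face_span_scale/face_span_face.
move=> h; rewrite -ltnS; apply: leq_trans h; apply: rank_ltmx.
by rewrite ltmxE addsmxSl addsmx_sub submx_refl.
Qed.

(** Induction on the dimension of the face of [x]. If [x] is not extreme, take [y] in its face but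
    off its ray and subtract maximal multiples: [x - s *: y] and [y - r *: x] have smaller faces,
    and together they recover [(1 - s * r) *: x]. *)
Theorem cone_generated x : C x -> generated C x.
Proof.
suff main k y : C y -> face_dim_le y k -> generated C y.
  by move=> Cx; apply: (main n) => // B _; exact: rank_leq_col.
move=> {x}; elim: k y => [|k IH] x Cx dx.
  have [->|x0] := eqVneq x 0; first exact: generated0.
  (* The matrix with all rows equal to [x] must have rank 0. *)
  have /dx : forall i, face_span x (row i ((const_mx 1 : 'cV_n) *m x)).
    move=> i; rewrite row_mul row_const -[const_mx 1]/(const_mx 1 : 'rV_1).
    rewrite [const_mx 1]mx11_scalar mxE mul_scalar_mx.
    by apply/face_span_scale/face_span_face/face_refl.
  rewrite leqn0 mxrank_eq0 => /eqP /matrixP xE.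
  case/eqP: x0; apply/rowP => i; have := xE i i.
  by rewrite !mxE big_ord1 mxE mul1r.
have [->|x0] := eqVneq x 0; first exact: generated0.
have [/generated_extreme//|nx] := pselect (extreme_ray C x).
have [y [z [t [Cy Cz t0 yz nyx]]]] : exists y z t,
    [/\ C y, C z, 0 <= t, y + z = t *: x & ~ ray x y].
  apply: contrapT => h; apply: nx; split=> // [_ [t t0 ->]|y z Cy Cz [t t0 yz]].
    exact: C_scale.
  split; apply: contrapT => nr; apply: h.
    by exists y, z, t.
  by exists z, y, t; split; rewrite // addrC.
have y0 : y != 0 by apply: contra_notN nyx => /eqP ->; exists 0; rewrite ?scale0r.
have fxy : face x y by split=> //; exists t; rewrite // -yz addrC addKr.
have [s [s0 Cs smax]] := max_subtract Cx Cy y0.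
have [r [r0 Cr rmax]] := max_subtract Cy Cx x0.
have fxx := face_refl Cx.
have g1 : generated C (x - s *: y).
  by apply: IH => //; exact: (face_dim_drop Cx Cy).
have g2 : generated C (y - r *: x).
  by apply: IH => //; exact: (face_dim_drop Cx Cx).
have E : (1 - s * r) *: x = (x - s *: y) + s *: (y - r *: x).
  by rewrite scalerBl scale1r scalerBr scalerA addrA subrK.
have xN a : a < 0 -> ~ C (a *: x).
  move=> a0 Ca; have : C (- x).
    have -> : - x = (- a)^-1 *: (a *: x).
      by rewrite scalerA invrN mulNr mulVf ?lt_eqF // scaleN1r.
    by apply: C_scale => //; rewrite invr_ge0 oppr_ge0 ltW.
  by move=> /(C_pointed Cx) x00; rewrite x00 eqxx in x0.
have CE : C ((1 - s * r) *: x) by rewrite E; apply: C_add => //; exact: C_scale.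
have [/xN//|sr0|sr] := ltgtP (1 - s * r) 0.
- have -> : x = (1 - s * r)^-1 *: ((x - s *: y) + s *: (y - r *: x)).
    by rewrite -E scalerA mulVf ?scale1r // gt_eqF.
  apply: generated_scale; first by rewrite invr_ge0 ltW.
  by apply: generated_add => //; exact: generated_scale.
(* Here [x - s *: y] and its opposite both lie in [C], so [x = s *: y], and [y] would be on the ray
   of [x]. *)
case: nyx; move: E; rewrite sr scale0r => /esym/eqP; rewrite addr_eq0 => /eqP E.
have x1 : x - s *: y = 0.
  by apply: C_pointed => //; rewrite E opprK; exact: C_scale.
have sn0 : s != 0 by apply: contraNneq x0 => sE; rewrite -x1 sE scale0r subr0.
exists s^-1; first by rewrite invr_ge0.
by move/eqP: x1; rewrite subr_eq0 => /eqP ->; rewrite scalerA mulVf // scale1r.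
Qed.

End Minkowski.
End Cones.

(** * Open cones and frames of extreme directions *)

Section OpenCone.
Variables (R : realType) (n : nat) (K : set 'rV[R]_n).
Hypothesis hK : open_convex_cone K.
Implicit Types (x y z w : 'rV[R]_n).

Lemma cone_scale a x : 0 < a -> K x -> K (a *: x).
Proof. by case: hK => _ _ h; exact: h. Qed.

Lemma cone_add x y : K x -> K y -> K (x + y).
Proof.
move=> Kx Ky; have [_ cK _] := hK.
have h0 : 0 <= 2^-1 :> R by rewrite invr_ge0.
have h1 : 2^-1 <= 1 :> R by rewrite invf_le1 // ler1n.
have h : K (2^-1 *: x + (1 - 2^-1) *: y) :=
  set_mem (cK x y (Itv01 h0 h1) (mem_set Kx) (mem_set Ky)).
have -> : x + y = 2 *: (2^-1 *: x + (1 - 2^-1) *: y).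
  by apply/rowP => i; rewrite !mxE; field.
exact: cone_scale.
Qed.

Lemma cone_line x y : K x ->
  exists2 e, 0 < e & forall s, `|s| <= e -> K (x + s *: y).
Proof.
move=> Kx; have [oK _ _] := hK.
have : nbhs (0 : R) ((fun s => x + s *: y) @^-1` K).
  apply: (continuous_line (x := x) (y := y)).
  by rewrite scale0r addr0; apply: open_nbhs_nbhs.
move=> /nbhs_ballP[e /= e0 eK]; exists (e / 2); first by rewrite divr_gt0.
move=> s se; apply: eK; rewrite /ball /= sub0r normrN (le_lt_trans se) //.
by rewrite ltr_pdivrMr // ltr_pMr // ltr1n.
Qed.

(** Since [K] is open, [v + e *: y] and [v - e *: y] both lie in [K] for small [e], which gives both
    signs for [phi y]. *)
Lemma linear_eq0_on_cone (phi : 'rV[R]_n -> R) v :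
  (forall a x y, phi (a *: x + y) = a * phi x + phi y) ->
  (forall x, K x -> 0 <= phi x) -> K v -> phi v = 0 -> forall y, phi y = 0.
Proof.
move=> lin phi0 Kv pv y; have [e e0 Ke] := cone_line y Kv.
have := phi0 _ (Ke e _); rewrite gtr0_norm // addrC lin pv addr0 => /(_ (lexx _)).
have := phi0 _ (Ke (- e) _); rewrite normrN gtr0_norm // addrC lin pv addr0.
move=> /(_ (lexx _)); rewrite mulNr oppr_ge0 !(pmulr_rle0, pmulr_rge0) // => h1 h2.
by apply/eqP; rewrite eq_le h1 h2.
Qed.

Lemma closure_cone_add x y : closure K x -> closure K y -> closure K (x + y).
Proof.
have tc (z : 'rV[R]_n) : continuous (fun t : 'rV[R]_n => z + t).
  by move=> t; apply: (cvgD (F := nbhs t)); [exact: cvg_cst|exact: cvg_id].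
have h1 z : K z -> closure K `<=` ((fun t => z + t) @^-1` closure K).
  move=> Kz; apply: closure_sub_closed.
    by apply: (proj1 (continuous_closedP _)) => //; exact: closed_closure.
  by move=> t Kt; apply: subset_closure; exact: cone_add.
move=> Cx; apply: (@closure_sub_closed _ K ((fun t => x + t) @^-1` closure K)).
  by apply: (proj1 (continuous_closedP _)) => //; exact: closed_closure.
by move=> t Kt /=; rewrite addrC; exact: h1.
Qed.

Lemma closure_cone_scale a x : 0 <= a -> closure K x -> closure K (a *: x).
Proof.
have pos b : 0 < b -> closure K x -> closure K (b *: x).
  move=> b0; apply: (@closure_sub_closed _ K ((fun t => b *: t) @^-1` closure K)).
    apply: (proj1 (continuous_closedP _)); last exact: closed_closure.
    by move=> t; apply: (cvgZl_tmp (F := nbhs t)); exact: cvg_id.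
  by move=> t Kt; apply: subset_closure; exact: cone_scale.
move=> a0 Cx; have [->|an0] := eqVneq a 0; last by apply: pos; rewrite // lt_def an0.
rewrite scale0r.
have : ((fun s => 0 + s *: x) @^-1` closure K) 0.
  apply: closed_right0.
    apply: (proj1 (continuous_closedP _)); last exact: closed_closure.
    exact: continuous_line.
  by move=> e e0 /=; rewrite add0r; exact: pos.
by rewrite /= scale0r addr0.
Qed.

Hypothesis K_pointed : pointed (closure K).

Lemma open_cone_generated x : K x -> generated (closure K) x.
Proof.
move=> Kx; apply: cone_generated => //; last exact: subset_closure.
- exact: closed_closure.
- exact: closure_cone_add.
- exact: closure_cone_scale.
Qed.

(** Says that [x] is in the algebraic interior of the cone generated by the rows of [U]. *)
Definition absorbs N (U : 'M[R]_(N, n)) x :=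
  forall y, exists2 t, 0 <= t & cone_of U (t *: x + y).

Lemma absorbs_colL N N' (U : 'M_(N, n)) (V : 'M_(N', n)) x :
  absorbs U x -> absorbs (col_mx U V) x.
Proof. by move=> h y; have [t t0 ?] := h y; exists t => //; exact: cone_of_colL. Qed.

Lemma absorbs_colR N N' (U : 'M_(N, n)) (V : 'M_(N', n)) x :
  absorbs V x -> absorbs (col_mx U V) x.
Proof. by move=> h y; have [t t0 ?] := h y; exists t => //; exact: cone_of_colR. Qed.

(** It suffices to absorb the basis vectors and their opposites; for each such [y], the point
    [x + e *: y] is still in [K] and Minkowski's theorem applies to it. *)
Lemma absorbing_family x : K x ->
  exists N (U : 'M_(N, n)),
    (forall i, unit_extreme (closure K) (row i U)) /\ absorbs U x.
Proof.
move=> Kx.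
have fam (Y : seq 'rV[R]_n) : exists N (U : 'M_(N, n)),
    (forall i, unit_extreme (closure K) (row i U)) /\
    forall y, y \in Y -> exists2 t, 0 <= t & cone_of U (t *: x + y).
  elim: Y => [|y Y [N [U [hU hY]]]]; first by exists 0%N, 0; split=> // -[].
  have [e e0 Ke] := cone_line y Kx.
  have : generated (closure K) (e^-1 *: (x + e *: y)).
    apply: generated_scale; first by rewrite invr_ge0 ltW.
    by apply/open_cone_generated/Ke; rewrite gtr0_norm.
  rewrite scalerDr scalerA mulVf ?gt_eqF // scale1r => -[N' [V [hV Vy]]].
  exists (N + N')%N, (col_mx U V); split; first exact: unit_extreme_col.
  move=> z; rewrite inE => /orP[/eqP ->|/hY [t t0 ?]].
    by exists e^-1; [rewrite invr_ge0 ltW|exact: cone_of_colR].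
  by exists t => //; exact: cone_of_colL.
pose D := [seq delta_mx ord0 i : 'rV[R]_n | i <- enum 'I_n].
have [N [U [hU hY]]] := fam (D ++ [seq - y | y <- D]).
exists N, U; split=> // y.
rewrite [y]row_sum_delta.
apply: (big_ind (fun y => exists2 t, 0 <= t & cone_of U (t *: x + y))).
- by exists 0 => //; rewrite scale0r addr0; exact: cone_of0.
- move=> y1 y2 [t1 t10 h1] [t2 t20 h2]; exists (t1 + t2); first exact: addr_ge0.
  by rewrite scalerDl addrACA; exact: cone_of_add.
move=> i _; set a := y ord0 i.
have iD : delta_mx ord0 i \in D by apply/mapP; exists i; rewrite ?mem_enum.
have [a0|a0] := leP 0 a.
  have [|t t0 h] := hY (delta_mx ord0 i); first by rewrite mem_cat iD.
  exists (a * t); first exact: mulr_ge0.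
  by rewrite -scalerA -scalerDr; exact: cone_of_scale.
have [|t t0 h] := hY (- delta_mx ord0 i).
  by rewrite mem_cat (map_f _ iD) orbT.
have na0 : 0 <= - a by rewrite oppr_ge0 ltW.
exists (- a * t); first exact: mulr_ge0.
have -> : a *: delta_mx ord0 i = (- a) *: (- delta_mx ord0 i : 'rV[R]_n).
  by rewrite scalerN scaleNr opprK.
by rewrite -scalerA -scalerDr; exact: cone_of_scale.
Qed.

Lemma absorbs_pos N (U : 'M_(N, n)) x : absorbs U x ->
  exists2 c : 'rV_N, forall i, 0 < c ord0 i & x = c *m U.
Proof.
(* Absorbing minus the sum of all rows forces every coefficient of [t *: x] to be at least 1.
   Absorbing [x] itself makes the final divisor positive. *)
move=> h; have [t t0 [c c0 E]] := h (- (const_mx 1 *m U)).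
have [t' t'0 [c' c'0 E']] := h x.
have s0 : 0 < t + (t' + 1) by rewrite ltr_wpDl // ltr_wpDl.
exists ((t + (t' + 1))^-1 *: (c + const_mx 1 + c')).
  move=> i; rewrite !mxE mulr_gt0 ?invr_gt0 // ltr_wpDr //.
  by rewrite ltr_wpDl.
rewrite -scalemxAl !mulmxDl -E -E' subrK.
have -> : t *: x + (t' *: x + x) = (t + (t' + 1)) *: x by rewrite !scalerDl scale1r.
by rewrite scalerA mulVf ?scale1r // gt_eqF.
Qed.

Lemma absorbs_span N (U : 'M_(N, n)) x : absorbs U x ->
  forall y, exists z : 'rV_N, y = z *m U.
Proof.
move=> h y; have [c _ xE] := absorbs_pos h; have [t t0 [e _ E]] := h y.
by exists (e - t *: c); rewrite mulmxBl -E -scalemxAl -xE addrC addKr.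
Qed.

(** Stacking the two families gives [v] and [w] positive coefficients in one frame, so the whole
    segment between them can be treated in the same coordinates. *)
Lemma common_frame v w : K v -> K w ->
  exists N (U : 'M_(N, n)) (a b : 'rV_N),
  [/\ forall i, extreme_units K (row i U),
      (forall i, 0 < a ord0 i) /\ v = a *m U,
      (forall i, 0 < b ord0 i) /\ w = b *m U &
      forall y, exists z : 'rV_N, y = z *m U].
Proof.
move=> /absorbing_family[N [U [hU Uv]]] /absorbing_family[N' [U' [hU' Uw]]].
have [a a0 vE] := absorbs_pos (absorbs_colL U' Uv).
have [b b0 wE] := absorbs_pos (absorbs_colR U Uw).
exists (N + N')%N, (col_mx U U'), a, b; split=> //.
  exact: unit_extreme_col.
exact: absorbs_span (absorbs_colL U' Uv).
Qed.

End OpenCone.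

(** * Calculus of directional derivatives of homogeneous polynomials *)

Section DirectionalDerivatives.
Variables (R : realType) (n : nat).
Implicit Types (g h : mpoly n R) (u v x y : 'rV[R]_n) (us vs : seq 'rV[R]_n).

Lemma dirD_linear u : linear (@dirD R n u).
Proof.
move=> a g h; rewrite /dirD scaler_sumr -big_split; apply: eq_bigr => i _ /=.
by rewrite mderivD mderivZ scalerDr !scalerA mulrC.
Qed.

HB.instance Definition _ u :=
  GRing.isLinear.Build R (mpoly n R) (mpoly n R) _ (@dirD R n u) (dirD_linear u).

Lemma dirDDl a u v g : dirD (a *: u + v) g = a *: dirD u g + dirD v g.
Proof.
rewrite /dirD scaler_sumr -big_split; apply: eq_bigr => i _ /=.
by rewrite !mxE scalerDl scalerA.
Qed.

Lemma dirD_sum I (r : seq I) (c : I -> R) (u : I -> 'rV[R]_n) g :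
  dirD (\sum_(i <- r) c i *: u i) g = \sum_(i <- r) c i *: dirD (u i) g.
Proof.
elim: r => [|i r IH]; last by rewrite !big_cons dirDDl IH.
by rewrite !big_nil /dirD big1 // => i _; rewrite mxE scale0r.
Qed.

Lemma dirDC u v g : dirD u (dirD v g) = dirD v (dirD u g).
Proof.
rewrite /dirD; under eq_bigr => i _ do rewrite (linear_sum (mderiv i)) scaler_sumr.
under [RHS]eq_bigr => i _ do rewrite (linear_sum (mderiv i)) scaler_sumr.
rewrite exchange_big; apply: eq_bigr => j _; apply: eq_bigr => i _ /=.
by rewrite !mderivZ !scalerA mulrC mderiv_comm.
Qed.

Lemma dirDs_linear us : linear (@dirDs R n us).
Proof. by elim: us => [|u us IH] a g h //=; rewrite IH linearP. Qed.

HB.instance Definition _ us :=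
  GRing.isLinear.Build R (mpoly n R) (mpoly n R) _ (@dirDs R n us) (dirDs_linear us).

Lemma dirDs_dirD us u g : dirDs us (dirD u g) = dirD u (dirDs us g).
Proof. by elim: us => //= v us ->; rewrite dirDC. Qed.

Lemma dirDs_cat us vs g : dirDs (us ++ vs) g = dirDs us (dirDs vs g).
Proof. by rewrite /dirDs foldr_cat. Qed.

Lemma iter_dirD k w g : iter k (dirD w) g = dirDs (nseq k w) g.
Proof. by elim: k => //= k ->. Qed.

Lemma const_coeff_linear : linear_for *%R (@const_coeff R n).
Proof. by move=> a g h; rewrite /const_coeff mcoeffD mcoeffZ. Qed.

HB.instance Definition _ :=
  GRing.isLinear.Build R (mpoly n R) R *%R (@const_coeff R n) const_coeff_linear.

Lemma homogeneous_mderiv d g i :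
  homogeneous d.+1 g -> homogeneous d (mderiv i g).
Proof.
move=> hg; apply/dhomogP => m; rewrite mcoeff_msupp mcoeff_mderiv => h.
apply/eqP; apply: contraNT h => md.
have mU : mdeg (mnm_add m (mnm1 i)) != d.+1 by rewrite mdegD mdeg1 addn1 eqSS.
by rewrite (dhomog_nemf_coeff hg mU) mul0rn.
Qed.

Lemma homogeneous_dirD d g u : homogeneous d.+1 g -> homogeneous d (dirD u g).
Proof.
move=> hg; apply: rpred_sum => i _; apply: rpredZ; exact: homogeneous_mderiv.
Qed.

Lemma homogeneous_dirDs d us g :
  homogeneous (size us + d) g -> homogeneous d (dirDs us g).
Proof.
elim: us d => //= u us IH d hg; apply: homogeneous_dirD; apply: IH.
by rewrite addnS.
Qed.

Lemma homogeneous_const_eq0 g : homogeneous 0 g -> const_coeff g = 0 -> g = 0.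
Proof.
move=> hg g0; apply/mpolyP => m; rewrite mcoeff0.
have [md|md] := eqVneq (mdeg m) 0%N; last exact: (dhomog_nemf_coeff hg).
by move/eqP: md; rewrite mdeg_eq0 => /eqP ->.
Qed.

Lemma homogeneous_mderiv_eq0 d g :
  homogeneous d.+1 g -> (forall i, mderiv i g = 0) -> g = 0.
Proof.
move=> hg g0; apply/mpolyP => m; rewrite mcoeff0.
have [md|md] := eqVneq (mdeg m) d.+1; last exact: (dhomog_nemf_coeff hg).
have [i mi] : exists i, m i != 0%N.
  apply/existsP; apply: contraPT md => /existsPn h; rewrite mdegE big1 // => i _.
  by have := h i; rewrite negbK => /eqP.
(* The coefficient of [m] in [g], multiplied by the nonzero exponent [m i], is a coefficient of the
   derivative. *)
have := mcoeff_mderiv i g (mnm_sub m (mnm1 i)); rewrite g0 mcoeff0 => /esym/eqP.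
rewrite mulrn_eq0 /= => /eqP; rewrite submK // lep1mP //.
Qed.

Lemma dirD_delta i g : dirD (delta_mx ord0 i) g = mderiv i g.
Proof.
rewrite /dirD (bigD1 i) //= mxE !eqxx scale1r big1 ?addr0 // => j ji.
by rewrite mxE (negbTE ji) andbF scale0r.
Qed.

Lemma const_dirDsDl us g a u v : const_coeff (dirDs us (dirD (a *: u + v) g)) =
  a * const_coeff (dirDs us (dirD u g)) + const_coeff (dirDs us (dirD v g)).
Proof. by rewrite dirDDl !linearP. Qed.

Lemma const_dirDs_sum us I (r : seq I) (c : I -> R) (u : I -> 'rV[R]_n) g :
  const_coeff (dirDs us (dirD (\sum_(i <- r) c i *: u i) g)) =
  \sum_(i <- r) c i * const_coeff (dirDs us (dirD (u i) g)).
Proof.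
by rewrite dirD_sum !linear_sum; apply: eq_bigr => i _; rewrite !linearZ.
Qed.

Lemma continuous_const_dirDs us g :
  continuous (fun u => const_coeff (dirDs us (dirD u g))).
Proof.
under eq_fun do rewrite [X in dirD X _]row_sum_delta const_dirDs_sum.
apply: continuous_big => i; apply: continuous_mul; first exact: coord_continuous.
exact: continuous_const.
Qed.

Lemma bil_form_mx g x y : bil (form_mx g) x y = const_coeff (dirD x (dirD y g)).
Proof.
rewrite bilE [x in RHS]row_sum_delta (const_dirDs_sum [::]) /=.
apply: eq_bigr => i _.
have -> : const_coeff (dirD (delta_mx ord0 i) (dirD y g)) =
    \sum_j y ord0 j * const_coeff (dirD (delta_mx ord0 i) (dirD (delta_mx ord0 j) g)).
  rewrite [in LHS](row_sum_delta y).
  exact: (const_dirDs_sum [:: delta_mx ord0 i]).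
by rewrite mulr_sumr; apply: eq_bigr => j _; rewrite mxE; ring.
Qed.

Lemma form_mx_sym g : (form_mx g)^T = form_mx g.
Proof. by apply/matrixP => i j; rewrite !mxE dirDC. Qed.

End DirectionalDerivatives.

(** * The closed form of the Lorentzian property *)

Definition all_in (R : realType) n (K : set 'rV[R]_n) (us : seq 'rV[R]_n) :=
  forall u, u \in us -> K u.

(* The closed counterpart of the Lorentzian property in degree [k + 2]:
   positivity is relaxed to nonnegativity, and the signature condition is
   expressed by reverse Cauchy-Schwarz inequalities.  Both pass to limits and
   hold trivially for the zero polynomial. *)
Definition weakly_Lorentzian (R : realType) n (K : set 'rV[R]_n) (k : nat)
    (g : mpoly n R) :=
  (forall us, size us = k.+2 -> all_in K us -> 0 <= const_coeff (dirDs us g)) /\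
  (forall us x v, size us = k -> all_in K us -> K v ->
     bil (form_mx (dirDs us g)) x x * bil (form_mx (dirDs us g)) v v <=
     bil (form_mx (dirDs us g)) x v ^+ 2).

Section WeaklyLorentzian.
Variables (R : realType) (n : nat) (K : set 'rV[R]_n).
Hypothesis hK : open_convex_cone K.
Implicit Types (g h q : mpoly n R) (u v w x y : 'rV[R]_n) (us vs : seq 'rV[R]_n).

Lemma all_in_cons u us : K u -> all_in K us -> all_in K (u :: us).
Proof. by move=> Ku Kus z; rewrite inE => /orP[/eqP ->|/Kus]. Qed.

Lemma all_in_consP u us : all_in K (u :: us) -> K u /\ all_in K us.
Proof.
by move=> h; split=> [|z zus]; apply: h; rewrite inE ?eqxx // zus orbT.
Qed.

Lemma all_in_cat us vs : all_in K us -> all_in K vs -> all_in K (us ++ vs).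
Proof. by move=> h1 h2 z; rewrite mem_cat => /orP[/h1|/h2]. Qed.

Lemma all_in_nseq k w : K w -> all_in K (nseq k w).
Proof. by move=> Kw z; rewrite mem_nseq => /andP[_ /eqP ->]. Qed.

Lemma bil_form_dirDs us g x y :
  bil (form_mx (dirDs us g)) x y = const_coeff (dirDs [:: x, y & us] g).
Proof. exact: bil_form_mx. Qed.

Lemma dirD_eq0_on_cone d g w : K w -> homogeneous d.+1 g ->
  (forall u, K u -> dirD u g = 0) -> g = 0.
Proof.
move=> Kw hg g0; apply: (homogeneous_mderiv_eq0 hg) => i.
apply/mpolyP => m; rewrite mcoeff0 -dirD_delta.
apply: (linear_eq0_on_cone hK (phi := fun u => mcoeff m (dirD u g)) (v := w)) => //.
- by move=> a x y; rewrite dirDDl mcoeffD mcoeffZ.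
- by move=> x Kx; rewrite g0 // mcoeff0.
- by rewrite g0 // mcoeff0.
Qed.

(** Applied to one direction at a time, [linear_eq0_on_cone] spreads a single zero to all
    directions. For nonzero [g] this upgrades nonnegativity to strict positivity. *)
Lemma homogeneous_eq0_at m g : homogeneous m g ->
  (forall us, size us = m -> all_in K us -> 0 <= const_coeff (dirDs us g)) ->
  forall vs, size vs = m -> all_in K vs -> const_coeff (dirDs vs g) = 0 -> g = 0.
Proof.
elim: m g => [|m IH] g hg g0 [|v vs] //=.
  by move=> _ _; exact: homogeneous_const_eq0.
move=> [svs] /all_in_consP[Kv Kvs]; rewrite -dirDs_dirD => vs0.
apply: (dirD_eq0_on_cone Kv hg) => u Ku.
apply: (IH _ (homogeneous_dirD u hg) _ vs) => //.
  move=> us sus Kus; rewrite dirDs_dirD.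
  by apply: (g0 (u :: us)); [rewrite /= sus|exact: all_in_cons].
apply: (linear_eq0_on_cone hK
  (phi := fun u => const_coeff (dirDs vs (dirD u g))) (v := v)) => //.
  by move=> a x y; exact: const_dirDsDl.
move=> x Kx; rewrite dirDs_dirD.
by apply: (g0 (x :: vs)); [rewrite /= svs|exact: all_in_cons].
Qed.

Lemma weakly_Lorentzian0 k : weakly_Lorentzian K k 0.
Proof.
split=> [us _ _|us x v _ _ _]; first by rewrite !linear0.
by rewrite !bil_form_dirDs !linear0 mul0r expr0n.
Qed.

Lemma all_in_tuple m us : size us = m -> all_in K us ->
  exists2 t : m.-tuple 'rV[R]_n, tval t = us & forall i, K (tnth t i).
Proof.
move=> /eqP sus Kus; exists (Tuple sus) => // i; apply: Kus.
exact: (mem_tnth i (Tuple sus)).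
Qed.

Lemma LorentzianP k g w : K w -> homogeneous k.+2 g ->
  Lorentzian K g <-> weakly_Lorentzian K k g.
Proof.
move=> Kw hg; have [->|gn0] := eqVneq g 0.
  split=> [_|_]; first exact: weakly_Lorentzian0.
  by left; exists 0 => //; rewrite mpolyC0.
split=> [[[c c0 gE]|[m [m1 hm hL]]]|[pos CS]].
- case/eqP: gn0; rewrite gE in hg *.
  have d0 : mdeg (@mnm0 n) != k.+2 by rewrite mdeg0.
  have := dhomog_nemf_coeff hg d0.
  by rewrite mcoeffC eqxx mulr1 => ->; rewrite mpolyC0.
- have mE : m = k.+2 := dhomog_uniq gn0 hm hg.
  rewrite {}mE in hm hL m1; split=> [us sus Kus|us x v sus Kus Kv].
    by have [t <- Kt] := all_in_tuple sus Kus; case: (hL t Kt) => /ltW.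
  (* Repeating [v] gives the positivity at [v] that [one_pos_eigenvalueP] asks for. *)
  have svus : size [:: v, v & us] = k.+2 by rewrite /= sus.
  have Kvus : all_in K [:: v, v & us] by do 2!apply: all_in_cons => //.
  have [t tE Kt] := all_in_tuple svus Kvus.
  have [] := hL t Kt; rewrite tE /= drop0 => p0 /(_ isT).
  by rewrite -bil_form_mx in p0; move/(one_pos_eigenvalueP (form_mx_sym _) p0).
right; exists k.+2; split=> // t Kt.
have Kvs (vs : seq 'rV[R]_n) : size vs = k.+2 -> all_in K vs ->
    0 < const_coeff (dirDs vs g).
  move=> svs Kvs; rewrite lt_def pos // andbT; apply: contraNN gn0 => /eqP g0.
  by apply/eqP; exact: (homogeneous_eq0_at hg pos svs).
have Kt' : all_in K t by move=> u /tnthP[i ->].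
split=> [|_]; first by apply: Kvs; rewrite ?size_tuple.
case: t Kt' {Kt} => -[|a [|b t]] //= /eqP[st] /all_in_consP[Ka /all_in_consP[_ Kt]].
rewrite drop0.
(* The form involves only the entries after the first two, so [a] may serve as both of its
   arguments. *)
have pa : 0 < bil (form_mx (dirDs t g)) a a.
  rewrite bil_form_dirDs; apply: Kvs; first by rewrite /= st.
  by do 2!apply: all_in_cons => //.
apply/(one_pos_eigenvalueP (form_mx_sym _) pa) => x.
exact: CS.
Qed.

(** Each condition defines a closed set of directions [u], and this set contains [K]. *)
Lemma weakly_Lorentzian_dirD k g u : weakly_Lorentzian K k.+1 g ->
  closure K u -> weakly_Lorentzian K k (dirD u g).
Proof.
move=> [pos CS] Cu; split=> [us sus Kus|us x v sus Kus Kv].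
  have c0 : continuous (fun _ : 'rV[R]_n => 0 : R) by exact: continuous_const.
  apply: (closure_sub_closed
    (closed_le_fun c0 (continuous_const_dirDs (us := us) (g := g))) _ Cu).
  move=> t Kt /=; rewrite dirDs_dirD.
  by apply: (pos (t :: us)); [rewrite /= sus|exact: all_in_cons].
have cB a b : continuous (fun u => bil (form_mx (dirDs us (dirD u g))) a b).
  under eq_fun do rewrite bil_form_dirDs; exact: continuous_const_dirDs.
apply: (closure_sub_closed (closed_le_fun (continuous_mul (cB x x) (cB v v))
  (continuous_sqr (cB x v))) _ Cu) => t Kt /=.
rewrite !dirDs_dirD; apply: (CS (t :: us)) => //; first by rewrite /= sus.
exact: all_in_cons.
Qed.

Lemma weakly_Lorentzian_dirDs k us g : weakly_Lorentzian K (size us + k) g ->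
  all_in (closure K) us -> weakly_Lorentzian K k (dirDs us g).
Proof.
elim: us k g => //= u us IH k g hg Kus; rewrite -dirDs_dirD; apply: IH.
  by apply: weakly_Lorentzian_dirD => //; apply: Kus; rewrite inE eqxx.
by move=> z zus; apply: Kus; rewrite inE zus orbT.
Qed.

End WeaklyLorentzian.

(** * Cubics: from extreme directions to all of the cone *)

Section CubicCase.
Variables (R : realType) (n : nat) (K : set 'rV[R]_n).
Hypothesis hK : open_convex_cone K.
Hypothesis K_pointed : pointed (closure K).
Implicit Types (g : mpoly n R) (u v w x y : 'rV[R]_n).

(* It suffices to test reverse Cauchy-Schwarz at one [v]: the signature does not
   depend on [v]. *)
Lemma weakly_Lorentzian_quadratic q v : homogeneous 2 q -> K v ->
  (forall us, size us = 2 -> all_in K us -> 0 <= const_coeff (dirDs us q)) ->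
  (forall x, bil (form_mx q) x x * bil (form_mx q) v v <= bil (form_mx q) x v ^+ 2) ->
  weakly_Lorentzian K 0 q.
Proof.
move=> hq Kv pos CS; split=> // us x v' /size0nil -> _ Kv' /=.
have Kvv z : K z -> all_in K [:: z; z] by move=> Kz; do 2!apply: all_in_cons => //.
have ge0 z : K z -> 0 <= bil (form_mx q) z z.
  by move=> Kz; rewrite bil_form_mx; exact: (pos [:: z; z] erefl (Kvv z Kz)).
have [v0|vn0] := eqVneq (bil (form_mx q) v v) 0.
  have -> : q = 0.
    apply: (homogeneous_eq0_at hK hq pos (vs := [:: v; v])) => //; first exact: Kvv.
    by rewrite -v0 bil_form_mx.
  by have [_ h] := weakly_Lorentzian0 K 0; exact: (h [::]).
have v_gt0 : 0 < bil (form_mx q) v v by rewrite lt_def vn0 ge0.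
have [v0|v'n0] := eqVneq (bil (form_mx q) v' v') 0; first by rewrite v0 mulr0 sqr_ge0.
have v'_gt0 : 0 < bil (form_mx q) v' v' by rewrite lt_def v'n0 ge0.
apply: (proj1 (one_pos_eigenvalueP (form_mx_sym _) v'_gt0)).
exact/(one_pos_eigenvalueP (form_mx_sym _) v_gt0).
Qed.

Section Frame.
Variables (g : mpoly n R) (N : nat) (U : 'M[R]_(N, n)).

(** The third derivative of [g] in the coordinates of the frame [U]; its symmetry is the commutation
    of derivatives. *)
Definition frame_tensor i : 'M[R]_N := U *m form_mx (dirD (row i U) g) *m U^T.

Lemma bil_frame_tensor i (x y : 'rV[R]_N) : bil (frame_tensor i) x y =
  const_coeff (dirD (x *m U) (dirD (y *m U) (dirD (row i U) g))).
Proof. by rewrite -bil_form_mx /bil /frame_tensor trmx_mul !mulmxA. Qed.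

Lemma frame_tensor_sym i : (frame_tensor i)^T = frame_tensor i.
Proof. by rewrite /frame_tensor !trmx_mul trmxK form_mx_sym mulmxA. Qed.

Lemma frame_tensor_swap i j k : frame_tensor i j k = frame_tensor j i k.
Proof.
rewrite -[LHS]bil_delta [LHS]bil_frame_tensor -[RHS]bil_delta [RHS]bil_frame_tensor.
rewrite -!rowE.
by rewrite (dirDC (row k U)) dirDC (dirDC (row j U)).
Qed.

Lemma tri_frame (c x y : 'rV[R]_N) : tri frame_tensor c x y =
  bil (form_mx (dirD (c *m U) g)) (x *m U) (y *m U).
Proof.
rewrite triE bil_form_mx (mulmx_sum_row c).
rewrite [RHS](const_dirDs_sum [:: x *m U; y *m U]).
by apply: eq_bigr => i _; rewrite bil_frame_tensor.
Qed.

End Frame.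

(** Nonnegativity is inherited from the extreme directions by linearity. Reverse Cauchy-Schwarz is
    carried from [w] to [v] by [good_path_end]. *)
Lemma cubic_transfer g v w : homogeneous 3 g -> K v -> K w ->
  (forall u, extreme_units K u -> weakly_Lorentzian K 0 (dirD u g)) ->
  weakly_Lorentzian K 0 (dirD w g) -> weakly_Lorentzian K 0 (dirD v g).
Proof.
move=> hg Kv Kw ext [_ CSw].
have [N [U [a [b [hU [a0 wE] [b0 vE] span]]]]] := common_frame hK K_pointed Kw Kv.
apply: (weakly_Lorentzian_quadratic (v := v)) => //.
- exact: homogeneous_dirD.
- move=> us sus Kus; rewrite vE mulmx_sum_row const_dirDs_sum.
  apply: sumr_ge0 => i _; apply: mulr_ge0; first exact: ltW.
  by have [pos _] := ext _ (hU i); exact: pos.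
pose p t := path_pt a b t.
have pE t : p t *m U = (1 - t) *: w + t *: v.
  by rewrite /p /path_pt mulmxDl -!scalemxAl -wE -vE.
have Kp (t : R) : 0 <= t <= 1 -> K (p t *m U).
  move=> /andP[t0 t1]; rewrite pE.
  have [->|tn0] := eqVneq t 0; first by rewrite subr0 scale1r scale0r addr0.
  have [->|tn1] := eqVneq t 1; first by rewrite subrr scale1r scale0r add0r.
  apply: (cone_add hK); apply: (cone_scale hK) => //.
    by rewrite subr_gt0 lt_def eq_sym tn1.
  by rewrite lt_def tn0.
have ge0 (t : R) i : 0 <= t <= 1 ->
    0 <= bil (frame_tensor g U i) (p t) (p t).
  move=> /Kp Kt; rewrite bil_frame_tensor.
  have [pos _] := ext _ (hU i); apply: (pos [:: p t *m U; p t *m U]) => //.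
  by do 2!apply: all_in_cons => //.
(* A slice vanishing at a point of [K] comes from a zero derivative, by [homogeneous_eq0_at]. *)
have eq0 (t : R) i : 0 <= t <= 1 ->
    bil (frame_tensor g U i) (p t) (p t) = 0 -> frame_tensor g U i = 0.
  move=> /Kp Kt; rewrite bil_frame_tensor => h0.
  have [pos _] := ext _ (hU i).
  have E : dirD (row i U) g = 0.
    apply: (homogeneous_eq0_at hK (homogeneous_dirD _ hg) pos
      (vs := [:: p t *m U; p t *m U])) => //.
    by do 2!apply: all_in_cons => //.
  rewrite /frame_tensor E; suff -> : form_mx (0 : mpoly n R) = 0.
    by rewrite mulmx0 mul0mx.
  by apply/matrixP => j k; rewrite !mxE !linear0.
have CS (t : R) i (x : 'rV[R]_N) : 0 <= t <= 1 ->
    bil (frame_tensor g U i) x x * bil (frame_tensor g U i) (p t) (p t) <=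
    bil (frame_tensor g U i) x (p t) ^+ 2.
  move=> /Kp Kt.
  rewrite !bil_frame_tensor -!bil_form_mx.
  by have [_ h] := ext _ (hU i); exact: (h [::]).
have p0 : p 0 *m U = w by rewrite pE subr0 scale1r scale0r addr0.
have p1 : p 1 *m U = v by rewrite pE subrr scale1r scale0r add0r.
have good0 : good (frame_tensor g U) a b 0.
  by move=> x; rewrite !tri_frame -/(p 0) p0; exact: (CSw [::]).
have good1 := good_path_end (@frame_tensor_sym g N U) (@frame_tensor_swap g N U)
  a0 b0 ge0 eq0 CS good0.
move=> x; have [z ->] := span x; rewrite -[in X in X <= _]p1 -[in X in _ <= X]p1.
by have := good1 z; rewrite !tri_frame.
Qed.

End CubicCase.

(** * Reduction to cubics and the equivalence *)

Section Reduction.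
Variables (R : realType) (n : nat) (K : set 'rV[R]_n).
Hypothesis hK : open_convex_cone K.
Hypothesis K_pointed : pointed (closure K).
Variable w : 'rV[R]_n.
Hypothesis Kw : K w.
Implicit Types (f g : mpoly n R) (u v : 'rV[R]_n) (us vs : seq 'rV[R]_n).

Lemma weakly_Lorentzian_of_quadratics m f : homogeneous m.+2 f ->
  (forall us, (size us <= m)%N -> all_in (extreme_units K) us ->
     weakly_Lorentzian K 0 (dirDs us (dirDs (nseq (m - size us) w) f))) ->
  weakly_Lorentzian K m f.
Proof.
elim: m f => [|m IH] f hf hyp; first exact: (hyp [::]).
(* The induction hypothesis applies to [D_u f], with [u] joining the list of extreme directions. *)
have ext u : extreme_units K u -> weakly_Lorentzian K m (dirD u f).
  move=> Eu; apply: IH; first exact: homogeneous_dirD.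
  move=> us sus Eus; rewrite !dirDs_dirD.
  by have := hyp (u :: us) sus (all_in_cons Eu Eus); rewrite /= subSS.
(* Copies of [w] are exchanged one by one for directions of [K]. Each exchange is [cubic_transfer]
   for the cubic obtained by differentiating [f] along [vs] and [m - j] copies of [w]. *)
have mixed j vs : (j <= m.+1)%N -> size vs = j -> all_in K vs ->
    weakly_Lorentzian K 0 (dirDs vs (dirDs (nseq (m.+1 - j) w) f)).
  elim: j vs => [|j IHj] vs jm.
    by move=> /size0nil -> _; have := hyp [::] (leq0n _); apply.
  case: vs => //= v vs [svs] /all_in_consP[Kv Kvs]; rewrite subSS.
  apply: (cubic_transfer hK K_pointed _ Kv Kw).
  - rewrite -dirDs_cat; apply: homogeneous_dirDs.
    by rewrite size_cat size_nseq svs subnKC // !addnS addn0.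
  - move=> u Eu; rewrite -dirDs_cat -dirDs_dirD.
    apply: weakly_Lorentzian_dirDs => //.
      by rewrite size_cat size_nseq svs subnKC // addn0; exact: ext.
    by move=> z /(all_in_cat Kvs (all_in_nseq Kw)); exact: subset_closure.
  have := IHj vs (ltnW jm) svs Kvs; rewrite ltnS in jm.
  by rewrite (subSn jm) [nseq _ _]/= [dirDs (_ :: _) _]/= dirDs_dirD.
have quad vs : size vs = m.+1 -> all_in K vs -> weakly_Lorentzian K 0 (dirDs vs f).
  by move=> svs Kvs; have := mixed _ _ (leqnn _) svs Kvs; rewrite subnn.
split=> [us sus Kus|us x v sus Kus Kv]; last first.
  by have [_ CS] := quad us sus Kus; exact: (CS [::]).
case: us sus Kus => [|a [|b us]] //= [sus] /all_in_consP[Ka /all_in_consP[Kb Kus]].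
have [pos _] := quad us sus Kus; apply: (pos [:: a; b]) => //.
by do 2!apply: all_in_cons => //.
Qed.

(** Without extreme directions, Minkowski's theorem would reduce [K] to the zero vector and all
    derivatives of [f] along [K] would vanish. *)
Lemma extreme_units_nonempty d f : homogeneous d.+1 f -> f != 0 ->
  exists u, extreme_units K u.
Proof.
move=> hf f0; apply: contrapT => noE; case/eqP: f0.
apply: (dirD_eq0_on_cone hK Kw hf) => u Ku.
have [N [U [hU [c _ uE]]]] := open_cone_generated hK K_pointed Ku.
suff -> : u = 0 by rewrite /dirD big1 // => i _; rewrite mxE scale0r.
case: N U hU c uE => [|N] U hU c ->; first by rewrite [U]flatmx0 mulmx0.
by case: noE; exists (row ord0 U); exact: hU.
Qed.

End Reduction.

Theorem theorem8p15 (R : realType) (n d : nat) (hd : (2 <= d)%N)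
    (f : mpoly n R) (hf : homogeneous d f)
    (K : set 'rV[R]_n) (hK : open_convex_cone K) (hKp : pointed (closure K))
    (w : 'rV[R]_n) (hw : K w) :
  Lorentzian K f <->
  (forall us : (d - 2).-tuple 'rV[R]_n,
     (forall i : 'I_(d - 2), extreme_units K (tnth us i)) ->
     forall k : nat, (k <= d - 2)%N ->
       Lorentzian K (dirDs (take k us) (iter (d - 2 - k) (dirD w) f))).
Proof.
case: d hd hf => [//|[//|k]] _ hf; rewrite !subSS subn0.
rewrite (LorentzianP hK hw hf).
split=> [wL us Eus j jk|hyp].
  have sz : size (take j us ++ nseq (k - j) w) = k.
    by rewrite size_cat size_nseq size_takel ?size_tuple // subnKC.
  rewrite iter_dirD -dirDs_cat.
  apply/(LorentzianP (k := 0) hK hw).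
    by apply: homogeneous_dirDs; rewrite sz addn2.
  apply: weakly_Lorentzian_dirDs => //; first by rewrite sz addn0.
  apply: all_in_cat; last first.
    by apply: all_in_nseq; exact: subset_closure.
  move=> u /mem_take /tnthP[i ->]; have [_ [_ rC _]] := Eus i.
  by apply: rC; exists 1 => //; rewrite scale1r.
(* The hypothesis quantifies over full tuples of extreme directions and may be vacuous when there
   are none; a nonzero [f] guarantees one. *)
have [->|f0] := eqVneq f 0; first exact: weakly_Lorentzian0.
have [u0 Eu0] := extreme_units_nonempty hK hKp hw hf f0.
apply: (weakly_Lorentzian_of_quadratics hK hKp hw hf) => us sus Eus.
apply/(LorentzianP (k := 0) hK hw).
  rewrite -dirDs_cat; apply: homogeneous_dirDs.
  by rewrite size_cat size_nseq subnKC // !addnS addn0.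
(* Shorter lists are padded with [u0] to the required length; [take] removes the padding. *)
have st : size (us ++ nseq (k - size us) u0) == k.
  by rewrite size_cat size_nseq subnKC.
have Et : all_in (extreme_units K) (us ++ nseq (k - size us) u0).
  by apply: all_in_cat => //; exact: all_in_nseq.
have := hyp (Tuple st) (fun i => Et _ (mem_tnth i (Tuple st))) (size us) sus.
by rewrite iter_dirD /= take_size_cat.
Qed.
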